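(* Let $D$ be a global Dedekind domain and $(\mathfrak a_i)_{i\in\mathbb N}$ any sequence of nonzero ideals of $D$. Put $Y:=\hat D-\bigcup_i\mathfrak a_i\hat D$ and $\mathcal Y:=\rho(Y)\subseteq\mathcal S(D)$. Then the analytic density of $\mathcal Y$ exists and $$d_{\rm an}(\mathcal Y)=\mu(Y)=\mu(\rho^{-1}(\mathcal Y)).$$
   Context: A global Dedekind domain is a ring $D$ whose fraction field $F$ is a global field (a finite extension of $\mathbb{Q}$ or of $\mathbb{F}_p(t)$) and for which there is a nonempty finite set $S$ of places of $F$, containing all archimedean places, such that $D=\{x\in F\mid v(x)\ge 0 \text{ for all places } v\notin S\}$. $\hat D=\varprojlim_{\mathfrak a}D/\mathfrak a$ is the profinite completion (nonzero ideals, discrete quotients), with Haar measure $\mu$, $\mu(\hat D)=1$. $\mathcal S(D)$ is the set of closed ideals of $\hat D$ and $\rho:\hat D\to\mathcal S(D)$ is $x\mapsto x\hat D$. The set $\mathcal I(D)$ of nonzero ideals of $D$ is regarded as a subset of $\mathcal S(D)$ via $\mathfrak n\mapsto\mathfrak n\hat D$. For $\mathfrak n\in\mathcal I(D)$ let $\|\mathfrak n\|=|D/\mathfrak n|$. For $\mathcal X\subseteq\mathcal S(D)$ and real $s>1$ set $\zeta_{\mathcal X}(s)=\sum_{\mathfrak n\in\mathcal X\cap\mathcal I(D)}\|\mathfrak n\|^{-s}$ and $\zeta_D=\zeta_{\mathcal I(D)}$; the upper and lower analytic densities are $d_{\rm an}^{+}(\mathcal X)=\limsup_{s\to1^+}\zeta_{\mathcal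 X}(s)/\zeta_D(s)$ and $d_{\rm an}^{-}(\mathcal X)=\liminf_{s\to1^+}\zeta_{\mathcal X}(s)/\zeta_D(s)$, and the analytic density $d_{\rm an}(\mathcal X)$ exists when they coincide. *)

(* Defs.v *)
From HB Require Import structures.
From mathcomp Require Import all_boot all_order all_algebra all_field.
From mathcomp Require Import generic_quotient ring_quotient fraction.
From mathcomp Require Import finmap.
From mathcomp Require Import all_classical all_reals all_analysis.

Set Implicit Arguments.
Unset Strict Implicit.
Unset Printing Implicit Defensive.

Import Order.TTheory GRing.Theory Num.Theory.
Import numFieldNormedType.Exports.

Local Open Scope classical_set_scope.
Local Open Scope ring_scope.
Local Open Scope quotient_scope.

(** ** Places of a field *)

Definition absolute_value (R : realType) (F : fieldType) (f : F -> R) : Prop :=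
  [/\ forall x, 0 <= f x,
      forall x, f x = 0 <-> x = 0,
      forall x y, f (x * y) = f x * f y &
      forall x y, f (x + y) <= f x + f y].

Definition nontrivial (R : realType) (F : fieldType) (f : F -> R) : Prop :=
  exists2 x, x != 0 & f x != 1.

Definition absolute_value_equiv (R : realType) (F : fieldType) (f g : F -> R) :
    Prop :=
  exists2 c : R, 0 < c & forall x, g x = f x `^ c.

(* A place is an equivalence class of nontrivial absolute values. *)
Definition places (R : realType) (F : fieldType) : set (set (F -> R)) :=
  [set v | exists f, [/\ absolute_value f, nontrivial f &
     v = [set g | absolute_value g /\ absolute_value_equiv f g]]].

Definition archimedean_place (R : realType) (F : fieldType)
    (v : set (F -> R)) : Prop :=
  exists2 f, v f & ~ (forall x y, f (x + y) <= Num.max (f x) (f y)).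

(* [v(x) >= 0] in additive notation, i.e. [|x|_v <= 1]; this does not depend on
   the absolute value chosen in the class. *)
Definition integral_at (R : realType) (F : fieldType) (v : set (F -> R))
    (x : F) : Prop :=
  forall f, v f -> f x <= 1.

(** ** Global fields and global Dedekind domains *)

Definition finite_extension (K F : fieldType) : Prop :=
  exists (L : fieldExtType K) (f : {rmorphism L -> F}), bijective f.

Definition global_field (F : fieldType) : Prop :=
  finite_extension rat F \/
  exists2 p : nat, prime p & finite_extension {fraction {poly 'F_p}} F.

Definition global_dedekind_domain (R : realType) (D : idomainType) : Prop :=
  global_field {fraction D} /\
  exists S : set (set ({fraction D} -> R)),
    [/\ finite_set S, S !=set0, S `<=` @places R {fraction D},
        forall v, @places R {fraction D} v -> archimedean_place v -> S v &
        forall x : {fraction D},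
          (exists d : D, x = tofrac d) <->
          (forall v, @places R {fraction D} v -> ~ S v -> integral_at v x)].

(** ** Nonzero ideals and residue rings *)

(* Unlike [idealr_closed], this allows the unit ideal. *)
Definition is_ideal (A : comPzRingType) (I : set A) : Prop :=
  [/\ I 0, forall x y, I x -> I y -> I (x + y) & forall r x, I x -> I (r * x)].

Record nzideal (D : idomainType) := NzIdeal {
  ideal_set :> set D;
  ideal_setP : is_ideal ideal_set;
  ideal_set_neq0 : exists2 x, ideal_set x & x != 0 }.

Lemma ideal_set_inj (D : idomainType) : injective (@ideal_set D).
Proof.
move=> [I I1 I2] [J J1 J2] /= IJ; rewrite -{}IJ in J1 J2 *.
by congr NzIdeal; exact: Prop_irrelevance.
Qed.

HB.instance Definition _ (D : idomainType) := gen_eqMixin (nzideal D).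
HB.instance Definition _ (D : idomainType) := gen_choiceMixin (nzideal D).

Definition ideal_pred (D : idomainType) (a : nzideal D) : pred D :=
  fun x => `[< ideal_set a x >].

Lemma ideal_pred_zmod_closed (D : idomainType) (a : nzideal D) :
  zmod_closed (ideal_pred a).
Proof.
have [a0 aD aM] := ideal_setP a.
split; first exact/asboolP.
move=> x y /asboolP ax /asboolP ay; apply/asboolP; apply: aD => //.
by rewrite -mulN1r; exact: aM.
Qed.

HB.instance Definition _ (D : idomainType) (a : nzideal D) :=
  GRing.isZmodClosed.Build D (ideal_pred a) (ideal_pred_zmod_closed a).

Definition ideal_zmod (D : idomainType) (a : nzideal D) : zmodClosed D :=
  GRing.ZmodClosed.clone D (ideal_pred a) _.

(* The additive quotient [D / a] of [ring_quotient], under an alias that can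
   carry the ring structure also when [a] is the unit ideal. *)
Definition residue (D : idomainType) (a : nzideal D) : Type :=
  Quotient.quot (ideal_zmod a).

HB.instance Definition _ (D : idomainType) (a : nzideal D) :=
  GRing.Zmodule.on (residue a).

Section Residue.
Variables (D : idomainType) (a : nzideal D).

Definition to_residue (d : D) : residue a :=
  \pi_(Quotient.quot (ideal_zmod a)) d.

Lemma to_residueP (d e : D) :
  to_residue d = to_residue e <-> ideal_set a (d - e).
Proof.
rewrite /to_residue; split=> [/eqP|h].
  by rewrite -Quotient.idealrBE => /asboolP.
by apply/eqP; rewrite -Quotient.idealrBE; apply/asboolP.
Qed.

Lemma to_residue_surj (x : residue a) : exists d, x = to_residue d.
Proof. by exists (repr x); rewrite /to_residue reprK. Qed.

Lemma to_residueD d e : to_residue (d + e) = to_residue d + to_residue e.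
Proof. exact: (raddfD \pi_(Quotient.quot (ideal_zmod a))). Qed.

Lemma to_residueN d : to_residue (- d) = - to_residue d.
Proof. exact: (raddfN \pi_(Quotient.quot (ideal_zmod a))). Qed.

Lemma to_residue0 : to_residue 0 = 0.
Proof. exact: (raddf0 \pi_(Quotient.quot (ideal_zmod a))). Qed.

Definition residue_mul (x y : residue a) : residue a :=
  to_residue (repr (x : Quotient.quot (ideal_zmod a)) *
              repr (y : Quotient.quot (ideal_zmod a))).

Lemma residue_mulE d e :
  residue_mul (to_residue d) (to_residue e) = to_residue (d * e).
Proof.
have [_ aD aM] := ideal_setP a; apply/to_residueP.
set d' := repr _; set e' := repr _.
have d'E : ideal_set a (d' - d).
  by apply/to_residueP; rewrite /to_residue reprK.
have e'E : ideal_set a (e' - e).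
  by apply/to_residueP; rewrite /to_residue reprK.
have -> : d' * e' - d * e = e' * (d' - d) + d * (e' - e).
  by rewrite !mulrBr addrA (mulrC e' d') (mulrC e' d) subrK.
by apply: aD; exact: aM.
Qed.

Let mulA : associative residue_mul.
Proof.
move=> x y z; case: (to_residue_surj x) (to_residue_surj y) (to_residue_surj z).
by move=> d -> [e ->] [f ->]; rewrite !residue_mulE mulrA.
Qed.

Let mulC : commutative residue_mul.
Proof.
move=> x y; case: (to_residue_surj x) (to_residue_surj y).
by move=> d -> [e ->]; rewrite !residue_mulE mulrC.
Qed.

Let mul1 : left_id (to_residue 1) residue_mul.
Proof.
by move=> x; case: (to_residue_surj x) => d ->; rewrite residue_mulE mul1r.
Qed.

Let mulDl : left_distributive residue_mul +%R.
Proof.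
move=> x y z; case: (to_residue_surj x) (to_residue_surj y) (to_residue_surj z).
move=> d -> [e ->] [f ->].
by rewrite -to_residueD !residue_mulE mulrDl to_residueD.
Qed.

HB.instance Definition _ :=
  GRing.Zmodule_isComPzRing.Build (residue a) mulA mulC mul1 mulDl.

Lemma to_residueM d e : to_residue (d * e) = to_residue d * to_residue e.
Proof. by rewrite -residue_mulE. Qed.

End Residue.

(* The cardinality of [D / n]; the junk value [0] when [D / n] is infinite. *)
Definition ideal_norm (D : idomainType) (n : nzideal D) : nat :=
  #|` fset_set [set: residue n] |%fset.

(** ** The profinite completion *)

(* The inverse limit as a subspace of the product of the discrete [D / a]: for
   [a] included in [b], the component at [b] is the image of the one at [a]. *)
Definition compatible_families (D : idomainType) :
    set (prod_topology (fun a : nzideal D => discrete_topology (residue a))) :=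
  [set x | forall a b : nzideal D, a `<=` b ->
     forall d : D, x a = to_residue a d -> x b = to_residue b d].

Definition profinite_completion (D : idomainType) : Type :=
  set_type (@compatible_families D).

HB.instance Definition _ (D : idomainType) :=
  Topological.on (profinite_completion D).

Section ProfiniteCompletion.
Variable D : idomainType.
Local Notation Dhat := (profinite_completion D).

Definition component (x : Dhat) (a : nzideal D) : residue a := sval x a.

Lemma componentP (x : Dhat) (a b : nzideal D) : a `<=` b ->
  forall d, component x a = to_residue a d -> component x b = to_residue b d.
Proof. by case: x => x /= /set_mem; exact. Qed.

Lemma component_inj (x y : Dhat) :
  (forall a, component x a = component y a) -> x = y.
Proof. by move=> xy; apply: val_inj; apply: functional_extensionality_dep. Qed.

Definition mk_profinite (x : forall a : nzideal D, residue a)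
    (xP : @compatible_families D x) : Dhat := exist _ x (mem_set xP).

Let zeroP : @compatible_families D (fun a => (0 : residue a)).
Proof.
move=> a b ab d; rewrite -!to_residue0 => /to_residueP h.
by apply/to_residueP; exact: ab.
Qed.

Let oneP : @compatible_families D (fun a => (1 : residue a)).
Proof. by move=> a b ab d /to_residueP h; apply/to_residueP; exact: ab. Qed.

Let embedP (d : D) : @compatible_families D (fun a => to_residue a d).
Proof. by move=> a b ab e /to_residueP h; apply/to_residueP; exact: ab. Qed.

Let oppP (x : Dhat) : @compatible_families D (fun a => - component x a).
Proof.
move=> a b ab d xa; apply/eqP; rewrite eqr_oppLR -to_residueN; apply/eqP.
by apply: (componentP ab); rewrite to_residueN -xa opprK.
Qed.

Let addP (x y : Dhat) :
  @compatible_families D (fun a => component x a + component y a).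
Proof.
move=> a b ab d.
have [e xe] := to_residue_surj (component x a).
have [f yf] := to_residue_surj (component y a).
rewrite xe yf (componentP ab xe) (componentP ab yf) -!to_residueD.
by move=> /to_residueP h; apply/to_residueP; exact: ab.
Qed.

Let mulP (x y : Dhat) :
  @compatible_families D (fun a => component x a * component y a).
Proof.
move=> a b ab d.
have [e xe] := to_residue_surj (component x a).
have [f yf] := to_residue_surj (component y a).
rewrite xe yf (componentP ab xe) (componentP ab yf) -!to_residueM.
by move=> /to_residueP h; apply/to_residueP; exact: ab.
Qed.

Let zero := mk_profinite zeroP.
Let one := mk_profinite oneP.
Let opp (x : Dhat) : Dhat := mk_profinite (@oppP x).
Let add (x y : Dhat) : Dhat := mk_profinite (@addP x y).
Let mul (x y : Dhat) : Dhat := mk_profinite (@mulP x y).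

Let addA : associative add.
Proof. by move=> x y z; apply: component_inj => a; exact: addrA. Qed.
Let addC : commutative add.
Proof. by move=> x y; apply: component_inj => a; exact: addrC. Qed.
Let add0 : left_id zero add.
Proof. by move=> x; apply: component_inj => a; exact: add0r. Qed.
Let addN : left_inverse zero opp add.
Proof. by move=> x; apply: component_inj => a; exact: addNr. Qed.
Let mulA : associative mul.
Proof. by move=> x y z; apply: component_inj => a; exact: mulrA. Qed.
Let mulC : commutative mul.
Proof. by move=> x y; apply: component_inj => a; exact: mulrC. Qed.
Let mul1 : left_id one mul.
Proof. by move=> x; apply: component_inj => a; exact: mul1r. Qed.
Let mulDl : left_distributive mul add.
Proof. by move=> x y z; apply: component_inj => a; exact: mulrDl. Qed.

HB.instance Definition _ := GRing.isZmodule.Build Dhat addA addC add0 addN.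
HB.instance Definition _ :=
  GRing.Zmodule_isComPzRing.Build Dhat mulA mulC mul1 mulDl.
HB.instance Definition _ := isPointed.Build Dhat 0.

Definition embed (d : D) : Dhat := mk_profinite (@embedP d).

Lemma componentD x y a : component (x + y) a = component x a + component y a.
Proof. by []. Qed.

Lemma componentM x y a : component (x * y) a = component x a * component y a.
Proof. by []. Qed.

Lemma component_embed d a : component (embed d) a = to_residue a d.
Proof. by []. Qed.

(* The ideal of the completion generated by the image of [n]. *)
Definition extended_ideal (n : nzideal D) : set Dhat :=
  smallest (@is_ideal Dhat) (embed @` n).

Definition closed_ideals : set (set Dhat) :=
  [set I : set Dhat | @is_ideal Dhat I /\ closed I].

(* The image of the nonzero ideals of [D] in [closed_ideals]. *)
Definition nonzero_ideals : set (set Dhat) := range extended_ideal.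

Definition rho (x : Dhat) : set Dhat := [set x * y | y in [set: Dhat]].

Definition borel : Type := g_sigma_algebraType (@open Dhat).

HB.instance Definition _ := Measurable.on borel.

End ProfiniteCompletion.

(* Together with the normalization contained in [probability], translation
   invariance characterizes the Haar measure of the compact additive group. *)
Definition haar_measure (R : realType) (D : idomainType)
    (mu : probability (borel D) R) : Prop :=
  forall (x : profinite_completion D) (A : set (borel D)), measurable A ->
    mu [set x + y | y in (A : set (profinite_completion D))] = mu A.

(** ** Analytic densities *)

Section Density.
Variables (R : realType) (D : idomainType).
Implicit Type X : set (set (profinite_completion D)).
Local Open Scope ereal_scope.

Definition zeta X (s : R) : \bar R :=
  \esum_(n in [set n : nzideal D | X (extended_ideal n)])
     ((ideal_norm n)%:R `^ (- s))%:E.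

Definition upper_analytic_density X : \bar R :=
  limf_esup (fun s : R => zeta X s / zeta (@nonzero_ideals D) s) (1%R : R)^'+.

Definition lower_analytic_density X : \bar R :=
  limf_einf (fun s : R => zeta X s / zeta (@nonzero_ideals D) s) (1%R : R)^'+.

Definition has_analytic_density X (d : \bar R) : Prop :=
  upper_analytic_density X = d /\ lower_analytic_density X = d.

End Density.

(* Main.v *)
Require Import Defs.
From mathcomp Require Import all_boot all_order all_algebra all_field.
From mathcomp Require Import finmap ring lra zify.
From mathcomp Require Import all_classical all_reals all_analysis.

Set Implicit Arguments.
Unset Strict Implicit.
Unset Printing Implicit Defensive.

Import Order.TTheory GRing.Theory Num.Theory.
Import numFieldNormedType.Exports.

Local Open Scope classical_set_scope.
Local Open Scope ring_scope.

(* For [s > 1] let [P_s] be the probability on the nonzero ideals giving [n] the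
   mass [|n|^-s / zeta_D(s)]. The [P_s]-probability of the multiples of [b] is
   [|b|^-s], and [b Dhat] has Haar measure [|b|^-1]; so, by inclusion-exclusion, for
   finitely many [a_i] the probability of the set of ideals contained in no [a_i]
   tends, as [s -> 1+], to the measure of the complement of the [a_i Dhat].
   Moreover this probability is nondecreasing in [s]: the set is stable under
   divisors, while under [P_s] the exponents of the primes are independent
   geometric variables that decrease with [s]. Hence for every [s > 1] it is at
   least that measure, a bound that survives the passage to infinitely many [a_i]
   and gives the lower density; the upper density is bounded by the finite case.

   The required arithmetic of [D] comes from two facts. As an intersection of
   valuation rings, [D] is completely integrally closed; and counting the words
   [\sum_i a ^+ i * x_i] in a basis of the global field over its prime or rational
   function subfield bounds [|D / a D|], so that the quotients are finite. These
   make every nonzero ideal invertible. The same bound, applied to few elements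
   meeting all ideals of norm below [2 ^ f], controls the number of primes of
   given size and hence the convergence of [zeta_D(s)] for [s > 1]. *)

(** * Residue systems and norms *)

Local Notation "x \inI I" := (ideal_set I x) (at level 70, no associativity).

Section Ideals.
Variable D : idomainType.
Implicit Types (I J K a b m n : nzideal D) (x y z : D) (s : seq D).

Lemma nzideal0 I : 0 \inI I. Proof. by case: (ideal_setP I). Qed.
Lemma nzidealD I x y : x \inI I -> y \inI I -> x + y \inI I.
Proof. by case: (ideal_setP I) => _ + _; exact. Qed.
Lemma nzidealMl I x y : y \inI I -> x * y \inI I.
Proof. by case: (ideal_setP I) => _ _; exact. Qed.
Lemma nzidealMr I x y : x \inI I -> x * y \inI I.
Proof. by rewrite mulrC; exact: nzidealMl. Qed.
Lemma nzidealN I x : x \inI I -> - x \inI I.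
Proof. by rewrite -mulN1r; exact: nzidealMl. Qed.
Lemma nzidealB I x y : x \inI I -> y \inI I -> x - y \inI I.
Proof. by move=> Ix Iy; apply: nzidealD => //; exact: nzidealN. Qed.
Lemma nzideal_subl I x y : x - y \inI I -> y \inI I -> x \inI I.
Proof. by move=> h Iy; rewrite -(subrK y x); exact: nzidealD. Qed.
Lemma nzideal_subC I x y : x - y \inI I -> y - x \inI I.
Proof. by move=> /nzidealN; rewrite opprB. Qed.
Lemma nzideal_trans I x y z : x - y \inI I -> y - z \inI I -> x - z \inI I.
Proof. by move=> h1 h2; rewrite -(subrKA y); exact: nzidealD. Qed.

Lemma nzideal_eq I J : (forall x, x \inI I <-> x \inI J) -> I = J.
Proof. by move=> h; apply: ideal_set_inj; apply/seteqP; split=> x /h. Qed.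

Lemma nzideal_anti I J : I `<=` J -> J `<=` I -> I = J.
Proof. by move=> IJ JI; apply: nzideal_eq => x; split; [exact: IJ|exact: JI]. Qed.

(** Residues are counted through lists of representatives in [D], which keeps the later
    combinatorics out of the quotient types. *)
Definition incongruent I s :=
  uniq s /\ {in s &, forall x y, x - y \inI I -> x = y}.

Definition complete_residues I s :=
  incongruent I s /\ forall x, exists2 y, y \in s & x - y \inI I.

Definition finite_residue I := finite_set [set: residue I].

Lemma map_residue_uniq I s : incongruent I s -> uniq [seq to_residue I x | x <- s].
Proof.
by move=> [us sI]; rewrite map_inj_in_uniq // => x y xs ys /to_residueP; exact: sI.
Qed.

Lemma complete_residues_norm I s : complete_residues I s ->
  finite_residue I /\ ideal_norm I = size s.
Proof.
move=> [sI sP].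
have E : [set: residue I] = [set` [seq to_residue I x | x <- s]].
  apply/seteqP; split=> // r _ /=.
  have [x ->] := to_residue_surj r; have [y ys xy] := sP x.
  by apply/mapP; exists y => //; apply/to_residueP.
have fI : finite_residue I by rewrite /finite_residue E; exact: finite_seq.
split=> //; rewrite /ideal_norm.
rewrite -(size_map (to_residue I)) -(undup_id (map_residue_uniq sI)) -card_fseq.
congr #|` _|; apply/fsetP => r; rewrite in_fset_set //= inE.
by rewrite in_setT; apply/esym; have : [set: residue I] r by []; rewrite E.
Qed.

Lemma ex_complete_residues I : finite_residue I ->
  exists2 s, complete_residues I s & size s = ideal_norm I.
Proof.
move=> fI; pose F := fset_set [set: residue I].
pose rep (r : residue I) : D := xget 0 [set x | r = to_residue I x].
have repE r : to_residue I (rep r) = r.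
  by rewrite /rep; case: xgetP => [x _ ->//|]; have [x xE] := to_residue_surj r; move/(_ x)/(_ xE).
pose s := [seq rep r | r <- enum_fset F].
have cs : complete_residues I s.
  split; last first.
    move=> x; exists (rep (to_residue I x)); last by apply/to_residueP; rewrite repE.
    by apply: map_f; rewrite /F in_fset_set ?in_setT.
  split; first by rewrite map_inj_uniq ?fset_uniq //; exact: can_inj repE.
  move=> x y /mapP[r _ ->] /mapP[t _ ->] /to_residueP.
  by rewrite !repE => ->.
by exists s => //; have [_ ->] := complete_residues_norm cs.
Qed.

Lemma uniq_residue_leq I (s : seq (residue I)) : finite_residue I -> uniq s ->
  (size s <= ideal_norm I)%N.
Proof.
move=> fI us; rewrite /ideal_norm.
by apply: uniq_leq_size => // r _; rewrite in_fset_set ?in_setT.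
Qed.

Lemma incongruent_leq_norm I s : finite_residue I -> incongruent I s ->
  (size s <= ideal_norm I)%N.
Proof.
move=> fI sI; rewrite -(size_map (to_residue I)).
by apply: uniq_residue_leq => //; exact: map_residue_uniq.
Qed.

(** A longest incongruent list is complete, since an element it does not represent could be added to
    it. Counting bounds thus yield finiteness of quotients. *)
Lemma incongruent_bound I (B : nat) :
  (forall s, incongruent I s -> (size s <= B)%N) ->
  finite_residue I /\ (ideal_norm I <= B)%N.
Proof.
move=> hB.
suff [s sI] : exists s, complete_residues I s.
  by have [fI ->] := complete_residues_norm sI; split=> //; apply: hB; case: sI.
have [s [sI smax]] : exists s, incongruent I s /\
    forall t, incongruent I t -> (size t <= size s)%N.
  apply: contrapT => no.
  (* Without a longest list there would be incongruent lists of every length, in particular of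
     length [B.+1]. *)
  suff: exists2 s, incongruent I s & size s = B.+1.
    by move=> [s /hB + sB]; rewrite sB ltnn.
  elim: B.+1 => [|k [s sI sk]]; first by exists [::].
  have [t [tI tk]] : exists t, incongruent I t /\ (size s < size t)%N.
    apply: contrapT => no'; apply: no; exists s; split=> // t tI.
    by rewrite leqNgt; apply/negP => st; apply: no'; exists t.
  exists (take k.+1 t); last by rewrite size_takel // -sk.
  case: tI => ut tI; split; first exact: take_uniq.
  by move=> x y /mem_take xt /mem_take yt; exact: tI.
exists s; split=> // x; apply: contrapT => no.
have := smax (x :: s); rewrite /= ltnn => /(_ _)/negP; apply=> //.
have [us sI'] := sI; split=> /=.
  rewrite us andbT; apply/negP => xs; apply: no; exists x => //.
  by rewrite subrr; exact: nzideal0.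
move=> y z; rewrite !inE => /orP[/eqP->|ys] /orP[/eqP->|zs] // h.
- by exfalso; apply: no; exists z.
- by exfalso; apply: no; exists y => //; exact: nzideal_subC.
- exact: sI'.
Qed.

Lemma ideal_norm_gt0 I : finite_residue I -> (0 < ideal_norm I)%N.
Proof.
move=> fI; apply: (@incongruent_leq_norm _ [:: 0]) => //; split=> // x y.
by rewrite !inE => /eqP-> /eqP->.
Qed.

Lemma finite_residue_sub I J : I `<=` J -> finite_residue I ->
  finite_residue J /\ (ideal_norm J <= ideal_norm I)%N.
Proof.
move=> IJ fI; apply: incongruent_bound => s [us sJ].
apply: incongruent_leq_norm => //; split=> // x y xs ys xy.
by apply: sJ => //; exact: IJ.
Qed.

(** A complete system modulo [J] is incongruent modulo [I], and remains so when [x + y] is added,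
    where [y] represents [0] and [x] lies in [J] but not in [I]. *)
Lemma ideal_norm_lt I J : I `<=` J -> finite_residue I -> I <> J ->
  (ideal_norm J < ideal_norm I)%N.
Proof.
move=> IJ fI neq; have [fJ _] := finite_residue_sub IJ fI.
have [x Jx Ix] : exists2 x, x \inI J & ~ x \inI I.
  apply: contrapT => no; apply: neq; apply: nzideal_anti => // x Jx.
  by apply: contrapT => Ix; apply: no; exists x.
have [s [[us sJ] sP] <-] := ex_complete_residues fJ.
have [y ys] := sP 0; rewrite sub0r => /nzidealN; rewrite opprK => Jy.
apply: (@incongruent_leq_norm I (x + y :: s)) => //.
have h z : z \in s -> ~ x + y - z \inI I.
  move=> zs xyz; have yz : y = z.
    apply: sJ => //; apply: nzidealB => //.
    have : x + y \inI J by apply: nzidealD.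
    move=> /nzidealB /(_ (IJ _ xyz)).
    by rewrite opprB addrC subrK.
  by move: xyz; rewrite yz addrK.
split=> /=.
  rewrite us andbT; apply/negP => /h; apply.
  by rewrite subrr; exact: nzideal0.
move=> z t; rewrite !inE => /orP[/eqP->|zs] /orP[/eqP->|ts] // zt.
- by case: (h _ ts).
- by case: (h _ zs); exact: nzideal_subC.
- by apply: sJ => //; exact: IJ.
Qed.

End Ideals.

(** * Operations on nonzero ideals *)

Section Operations.
Variable D : idomainType.
Implicit Types (I J K M N P a b m n : nzideal D) (x y z c d : D) (s : seq D).

Lemma ideal1_ideal : @is_ideal D [set: D]. Proof. by []. Qed.
Lemma ideal1_neq0 : exists2 x, [set: D] x & x != 0.
Proof. by exists 1 => //; exact: oner_neq0. Qed.
Definition ideal1 : nzideal D := NzIdeal ideal1_ideal ideal1_neq0.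

(* The unit ideal when [c = 0], so that the construction is total. *)
Lemma pideal_ideal c : @is_ideal D [set x | c = 0 \/ exists d, x = c * d].
Proof.
split=> [|x y [->|[d ->]] [|[e ->]]|r x [->|[d ->]]]; try by left.
- by right; exists 0; rewrite mulr0.
- by right; exists (d + e); rewrite mulrDr.
- by right; exists (r * d); rewrite mulrCA.
Qed.
Lemma pideal_neq0 c : exists2 x, [set x | c = 0 \/ exists d, x = c * d] x & x != 0.
Proof.
have [->|c0] := eqVneq c 0; first by exists 1; [left|exact: oner_neq0].
by exists c => //; right; exists 1; rewrite mulr1.
Qed.
Definition pideal c : nzideal D := NzIdeal (@pideal_ideal c) (pideal_neq0 c).

Lemma pidealP c x : c != 0 -> x \inI pideal c <-> exists d, x = c * d.
Proof. by move=> /eqP c0; split=> [[]//|h]; right. Qed.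

Lemma pideal_id c : c \inI pideal c.
Proof. by right; exists 1; rewrite mulr1. Qed.

Lemma pideal_sub c I : c != 0 -> c \inI I -> pideal c `<=` I.
Proof. by move=> c0 cI x /(pidealP _ c0)[d ->]; exact: nzidealMr. Qed.

Lemma prod_ideal (A B : set D) :
  is_ideal (smallest (@is_ideal D) [set x * y | x in A & y in B]).
Proof.
split=> [K [[]]//|x y hx hy K [hK h]|r x hx K [hK h]]; case: (hK) => h0 hD hM.
  by apply: hD; [exact: hx|exact: hy].
by apply: hM; exact: hx.
Qed.
Lemma prod_neq0 I J : exists2 x,
  smallest (@is_ideal D) [set x * y | x in ideal_set I & y in ideal_set J] x & x != 0.
Proof.
have [x Ix x0] := ideal_set_neq0 I; have [y Jy y0] := ideal_set_neq0 J.
exists (x * y); last by rewrite mulf_neq0.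
by move=> K [_]; apply; exists x => //; exists y.
Qed.
Definition idealM I J : nzideal D := NzIdeal (prod_ideal I J) (prod_neq0 I J).

Lemma idealM_in I J x y : x \inI I -> y \inI J -> x * y \inI idealM I J.
Proof. by move=> Ix Jy K [_]; apply; exists x => //; exists y. Qed.

Lemma idealM_ind I J (K : set D) : is_ideal K ->
  (forall x y, x \inI I -> y \inI J -> K (x * y)) -> ideal_set (idealM I J) `<=` K.
Proof. by move=> hK h z; apply; split=> // _ [x Ix [y Jy <-]]; exact: h. Qed.

Lemma idealM_sub I J K : (forall x y, x \inI I -> y \inI J -> x * y \inI K) ->
  idealM I J `<=` K.
Proof. by apply: idealM_ind; exact: ideal_setP. Qed.

Lemma idealMC I J : idealM I J = idealM J I.
Proof.
by apply: nzideal_anti; apply: idealM_sub => x y Ix Jy; rewrite mulrC; exact: idealM_in.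
Qed.

Lemma colon_ideal I (A : set D) : is_ideal [set x | forall y, A y -> x * y \inI I].
Proof.
split=> [y _|x z hx hz y Ay|r x hx y Ay] /=.
- by rewrite mul0r; exact: nzideal0.
- by rewrite mulrDl; apply: nzidealD; [exact: hx|exact: hz].
- by rewrite -mulrA; apply: nzidealMl; exact: hx.
Qed.
Lemma colon_neq0 I (A : set D) : exists2 x, [set x | forall y, A y -> x * y \inI I] x & x != 0.
Proof. by have [x Ix x0] := ideal_set_neq0 I; exists x => // y _; exact: nzidealMr. Qed.
(** The divisor is an arbitrary set, so that quotients by an ideal and by a single element are
    instances of one construction. *)
Definition colon I (A : set D) : nzideal D :=
  NzIdeal (colon_ideal I A) (colon_neq0 I A).

Lemma idealM_colon I J K : (idealM K J `<=` I) <-> (K `<=` colon I J).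
Proof.
split=> [h x Kx y Jy|h]; first by apply: h; exact: idealM_in.
by apply: idealM_sub => x y Kx; exact: h.
Qed.

(** The adjunction [idealM_colon] reduces one inclusion to products of generators; commutativity
    gives the other. *)
Lemma idealMA I J K : idealM I (idealM J K) = idealM (idealM I J) K.
Proof.
have sub (I' J' K' : nzideal D) :
    idealM I' (idealM J' K') `<=` idealM (idealM I' J') K'.
  rewrite idealMC; apply/idealM_colon; apply: idealM_sub => x y Jx Ky z Iz.
  by rewrite mulrC mulrA; apply: idealM_in => //; exact: idealM_in.
apply: nzideal_anti; first exact: sub.
by rewrite (idealMC _ K) (idealMC I) (idealMC I (idealM J K)) (idealMC J K); exact: sub.
Qed.

Lemma ideal1M I : idealM ideal1 I = I.
Proof.
apply: nzideal_anti; first by apply: idealM_sub => x y _; exact: nzidealMl.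
by move=> x Ix; rewrite -(mul1r x); exact: idealM_in.
Qed.

Lemma idealMl_sub I J : idealM I J `<=` I.
Proof. by apply: idealM_sub => x y Ix _; exact: nzidealMr. Qed.

Lemma idealMr_sub I J : idealM I J `<=` J.
Proof. by apply: idealM_sub => x y _; exact: nzidealMl. Qed.

Lemma idealMS I J K : J `<=` K -> idealM I J `<=` idealM I K.
Proof. by move=> JK; apply: idealM_sub => x y Ix /JK; exact: idealM_in. Qed.

Lemma pidealMP c I x : c != 0 ->
  x \inI idealM (pideal c) I <-> exists2 y, y \inI I & x = c * y.
Proof.
move=> c0; split=> [|[y Iy ->]]; last by apply: idealM_in => //; exact: pideal_id.
apply: (@idealM_ind _ _ [set x | exists2 y, y \inI I & x = c * y]); last first.
  by move=> z y /(pidealP _ c0)[d ->] Iy; exists (d * y); rewrite ?mulrA//; exact: nzidealMl.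
split=> [|z y [x' Ix ->] [y' Iy ->]|r z [x' Ix ->]].
- by exists 0; rewrite ?mulr0//; exact: nzideal0.
- by exists (x' + y'); rewrite ?mulrDr//; exact: nzidealD.
- by exists (r * x'); [exact: nzidealMl|rewrite mulrCA].
Qed.

Lemma pidealM_subK c I J : c != 0 ->
  idealM (pideal c) I `<=` idealM (pideal c) J -> I `<=` J.
Proof.
move=> c0 h x Ix; have /(pidealMP _ _ c0)[y Jy] : c * x \inI idealM (pideal c) J.
  by apply: h; apply/(pidealMP _ _ c0); exists x.
by move=> /(mulfI c0) ->.
Qed.

Lemma cap_ideal I J : is_ideal (ideal_set I `&` ideal_set J).
Proof.
split=> [|x y [Ix Jx] [Iy Jy]|r x [Ix Jx]]; split.
- exact: nzideal0.
- exact: nzideal0.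
- exact: nzidealD.
- exact: nzidealD.
- exact: nzidealMl.
- exact: nzidealMl.
Qed.
Lemma cap_neq0 I J : exists2 x, (ideal_set I `&` ideal_set J) x & x != 0.
Proof.
have [x xIJ x0] := ideal_set_neq0 (idealM I J); exists x => //.
by split; [apply: idealMl_sub xIJ|apply: idealMr_sub xIJ].
Qed.
Definition idealI I J : nzideal D := NzIdeal (cap_ideal I J) (cap_neq0 I J).

Lemma add_ideal (x : D) I : is_ideal [set z | exists y r, y \inI I /\ z = r * x + y].
Proof.
split=> [|z t [y [r [Iy ->]]] [u [v [Iu ->]]]|q z [y [r [Iy ->]]]].
- by exists 0, 0; split; [exact: nzideal0|rewrite mul0r addr0].
- by exists (y + u), (r + v); split; [exact: nzidealD|ring].
- by exists (q * y), (q * r); split; [exact: nzidealMl|ring].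
Qed.
Lemma add_neq0 (x : D) I : exists2 z, [set z | exists y r, y \inI I /\ z = r * x + y] z & z != 0.
Proof.
have [y Iy y0] := ideal_set_neq0 I; exists y => //; exists y, 0; split=> //.
by rewrite mul0r add0r.
Qed.
Definition adjoin x I : nzideal D := NzIdeal (@add_ideal x I) (add_neq0 x I).

Lemma adjoin_sub x I : I `<=` adjoin x I.
Proof. by move=> y Iy; exists y, 0; split=> //; rewrite mul0r add0r. Qed.

Lemma adjoin_id x I : x \inI adjoin x I.
Proof. by exists 0, 1; split; [exact: nzideal0|rewrite mul1r addr0]. Qed.

Lemma sum_ideal I J : is_ideal [set z | exists x y, [/\ x \inI I, y \inI J & z = x + y]].
Proof.
split=> [|_ _ [x [y [Ix Jy ->]]] [z [t [Iz Jt ->]]]|r _ [x [y [Ix Jy ->]]]].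
- by exists 0, 0; rewrite addr0; split=> //; exact: nzideal0.
- by exists (x + z), (y + t); rewrite addrACA; split=> //; exact: nzidealD.
- by exists (r * x), (r * y); rewrite mulrDr; split=> //; exact: nzidealMl.
Qed.
Lemma sum_neq0 I J :
  exists2 z, [set z | exists x y, [/\ x \inI I, y \inI J & z = x + y]] z & z != 0.
Proof.
have [x Ix x0] := ideal_set_neq0 I; exists x => //; exists x, 0.
by rewrite addr0; split=> //; exact: nzideal0.
Qed.
Definition idealD I J : nzideal D := NzIdeal (sum_ideal I J) (sum_neq0 I J).

Lemma idealDl_sub I J : I `<=` idealD I J.
Proof. by move=> x Ix; exists x, 0; rewrite addr0; split=> //; exact: nzideal0. Qed.

Lemma idealDr_sub I J : J `<=` idealD I J.
Proof. by move=> x Ix; exists 0, x; rewrite add0r; split=> //; exact: nzideal0. Qed.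

Definition coprime_ideal I J := exists x y, [/\ x \inI I, y \inI J & x + y = 1].

Lemma eq_ideal1 I : 1 \inI I -> I = ideal1.
Proof.
by move=> h; apply: nzideal_anti => // x _; rewrite -(mulr1 x); exact: nzidealMl.
Qed.

Definition maximal P := P <> ideal1 /\ forall I, P `<=` I -> I = P \/ I = ideal1.

Lemma maximal_coprime P I : maximal P -> ~ (I `<=` P) -> coprime_ideal I P.
Proof.
move=> [P1 Pmax] IP.
have [x Ix Px] : exists2 x, x \inI I & ~ x \inI P.
  apply: contrapT => no; apply: IP => x Ix; apply: contrapT => Px.
  by apply: no; exists x.
have [E|E] := Pmax _ (@adjoin_sub x P).
  by case: Px; rewrite -E; exact: adjoin_id.
have : 1 \inI adjoin x P by rewrite E.
move=> [y [r [Py e]]]; exists (r * x), y; split=> //; exact: nzidealMl.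
Qed.

Lemma coprime_colon I J : coprime_ideal I J -> colon I J = I.
Proof.
move=> [u [v [Iu Jv uv]]]; apply: nzideal_anti => x.
  move=> /(_ _ Jv) h; rewrite -(mulr1 x) -uv mulrDr; apply: nzidealD => //.
  exact: nzidealMl.
by move=> Ix y _; exact: nzidealMr.
Qed.

Lemma maximal_prime P I J : maximal P -> idealM I J `<=` P -> I `<=` P \/ J `<=` P.
Proof.
move=> Pm h; have [IP|IP] := pselect (I `<=` P); [by left|right].
move=> y Jy; have [u [v [Iu Pv uv]]] := maximal_coprime Pm IP.
rewrite -(mul1r y) -uv mulrDl; apply: nzidealD; last exact: nzidealMr.
by apply: h; exact: idealM_in.
Qed.

Lemma maximal_neq P Q : maximal P -> maximal Q -> P <> Q -> ~ (P `<=` Q).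
Proof. by move=> [_ Pm] [Q1 _] PQ /Pm[E|//]; apply: PQ. Qed.

End Operations.

(** * Invertibility and multiplicativity of the norm *)

(** The relation says [y k = (b / c) ^+ k * y 0]: the powers of [b / c] have the common denominator
    [y 0]. It is phrased inside [D], without fractions. *)
Definition completely_integrally_closed (D : idomainType) :=
  forall (b c : D) (y : nat -> D), c != 0 -> y 0%N != 0 ->
    (forall k, c * y k.+1 = b * y k) -> exists d, b = c * d.

Section Dedekind.
Variable D : idomainType.
Hypothesis finD : forall I : nzideal D, finite_residue I.
Hypothesis cicD : completely_integrally_closed D.
Implicit Types (I J K M N P a m n : nzideal D) (b x y z c d : D) (s : seq D).

(* Take [b] with [b D + (c)] minimal among the [b] that no element of [1 + J]
   sends into [(c)]. *)
Lemma ex_annihilator J c : c != 0 -> c \inI J -> J <> ideal1 D ->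
  exists b, ~ b \inI pideal c /\ forall x, x \inI J -> b * x \inI pideal c.
Proof.
move=> c0 cJ J1.
have cJ' : pideal c `<=` J by exact: pideal_sub.
pose adm b := forall r, 1 - r \inI J -> ~ r * b \inI pideal c.
pose nb b := ideal_norm (adjoin b (pideal c)).
have adm1 : adm 1.
  move=> r rJ; rewrite mulr1 => /cJ' rJ'; apply: J1; apply: eq_ideal1.
  by rewrite -(subrK r 1); exact: nzidealD.
have exk : exists k, `[< exists2 b, adm b & nb b = k >].
  by exists (nb 1); apply/asboolP; exists 1.
have ubk k : `[< exists2 b, adm b & nb b = k >] -> (k <= ideal_norm (pideal c))%N.
  move=> /asboolP[b _ <-].
  by have [] := finite_residue_sub (@adjoin_sub _ b (pideal c)) (finD _).
(* A minimal ideal is one of maximal norm, and these norms are bounded by that of [(c)]. *)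
case: (ex_maxnP exk ubk) => k /asboolP[b admb nbk] kmax.
have eqb t : adm (b * t) -> exists e y, y \inI pideal c /\ b = e * (b * t) + y.
  move=> admbt; suff: b \inI adjoin (b * t) (pideal c).
    by move=> [y [e [yc E]]]; exists e, y.
  have sub : adjoin (b * t) (pideal c) `<=` adjoin b (pideal c).
    by move=> _ [y [r [yc ->]]]; exists y, (r * t); split=> //; rewrite (mulrC b) mulrA.
  have [->|neq] := pselect (adjoin (b * t) (pideal c) = adjoin b (pideal c)).
    exact: adjoin_id.
  have := ideal_norm_lt sub (finD _) neq; rewrite -/(nb b) -/(nb (b * t)) nbk.
  rewrite ltnNge => /negP[]; apply: kmax; apply/asboolP; by exists (b * t).
exists b; split=> [bc|x xJ].
  by apply: (admb 1); rewrite ?subrr ?mul1r//; exact: nzideal0.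
have [/eqb[e [y [yc E]]]|] := pselect (adm (b * x)).
  (* Here [b = e * (b * x) + y] with [y] in [(c)], so [1 - e * x], which is [1] modulo [J], sends
     [b] into [(c)]. *)
  exfalso; apply: (admb (1 - e * x)).
    by rewrite opprB addrC subrK; exact: nzidealMl.
  by rewrite mulrBl mul1r {1}E mulrAC -mulrA addrAC subrr add0r.
move=> /existsNP[r /not_implyP[rJ /contrapT rbx]].
(* As [r] is [1] modulo [J], [b * r] is admissible too, and minimality puts [b] into
   [(b * r) + (c)]. Since [r * (b * x)] is in [(c)], so is [b * x]. *)
have /eqb[e [y [yc E]]] : adm (b * r).
  move=> q qJ; rewrite mulrCA mulrC; apply: admb.
  have -> : 1 - q * r = (1 - q) + q * (1 - r) by ring.
  by apply: nzidealD => //; apply: nzidealMl.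
rewrite E mulrDl; apply: nzidealD; last exact: nzidealMr.
rewrite -mulrA; apply: nzidealMl.
by rewrite (mulrC b) -mulrA.
Qed.

(** Let [I' = (c) : I] and [J = I I' : c]. If [J] were proper, [ex_annihilator] would give [b]
    outside [(c)] with [b J] inside [(c)]. Then [b / c] maps [I'] to itself; its iterates at [c]
    stay in [D], and complete integral closedness forces [b] into [(c)]. *)
Lemma ideal_invertible I : exists J c, c != 0 /\ idealM I J = pideal c.
Proof.
have [c cI c0] := ideal_set_neq0 I.
pose I' := colon (pideal c) I.
have cI' : c \inI I' by move=> y _; apply: nzidealMr; exact: pideal_id.
have sub : idealM I I' `<=` pideal c by rewrite idealMC; apply/idealM_colon.
exists I', c; split=> //; apply: nzideal_anti => //.
pose J := colon (idealM I I') [set c].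
have JP x : x * c \inI idealM I I' -> x \inI J by move=> h _ ->.
have cJ : c \inI J by apply: JP; exact: idealM_in.
suff J1 : J = ideal1 D.
  apply: pideal_sub => //.
  have : 1 \inI J by rewrite J1.
  by move=> /(_ c erefl); rewrite mul1r.
apply: contrapT => /(ex_annihilator c0 cJ)[b [bc bJ]].
have step y : y \inI I' -> exists2 y', y' \inI I' & c * y' = b * y.
  move=> yI'; have yJ : y \inI J by apply: JP; rewrite mulrC; exact: idealM_in.
  have /(pidealP _ c0)[y' y'E] := bJ _ yJ; exists y' => // i iI.
  have /(pidealP _ c0)[w wE] := yI' _ iI.
  have wJ : w \inI J by apply: JP; rewrite mulrC -wE mulrC; exact: idealM_in.
  have /(pidealP _ c0)[v vE] := bJ _ wJ; apply/(pidealP _ c0); exists v.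
  by apply: (mulfI c0); rewrite mulrA -y'E -mulrA wE mulrCA vE.
pose f y := xget 0 [set y' | y' \inI I' /\ c * y' = b * y].
have fP y : y \inI I' -> f y \inI I' /\ c * f y = b * y.
  move=> /step[y' y'I y'E]; rewrite /f; case: xgetP => [z _ []//|no].
  by case: (no y').
have iterP k : iter k f c \inI I' by elim: k => //= k /fP[].
have [d bE] : exists d, b = c * d.
  by apply: (cicD (y := fun k => iter k f c)) => // k; have [] := fP _ (iterP k).
by apply: bc; apply/(pidealP _ c0); exists d.
Qed.

Lemma idealM_subK I J K : idealM I J `<=` idealM I K -> J `<=` K.
Proof.
have [I' [c [c0 E]]] := ideal_invertible I => h.
apply: (pidealM_subK c0); rewrite -E (idealMC I) -!idealMA; exact: idealMS.
Qed.

Lemma idealMI I : injective (idealM I).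
Proof. by move=> J K E; apply: nzideal_anti; apply: (@idealM_subK I); rewrite E. Qed.

(** With [I I' = (c)], the cofactor is [I' J] divided by [c], written as a colon ideal. *)
Lemma ideal_dvd I J : J `<=` I -> exists M, J = idealM I M.
Proof.
move=> JI; have [I' [c [c0 E]]] := ideal_invertible I.
exists (colon (idealM I' J) [set c]).
apply: (@idealMI I'); rewrite idealMA (idealMC I' I) E.
apply: nzideal_anti => x.
  move=> xIJ; have : x \inI pideal c.
    by rewrite -E idealMC; apply: (idealMS JI).
  move=> /(pidealP _ c0)[d xE]; apply/(pidealMP _ _ c0); exists d => // _ ->.
  by rewrite mulrC -xE.
by move=> /(pidealMP _ _ c0)[y /(_ c erefl) + ->]; rewrite mulrC.
Qed.

Lemma ex_maximal I : I <> ideal1 D -> exists2 P, maximal P & I `<=` P.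
Proof.
have [k] := ubnP (ideal_norm I); elim: k I => // k IH I Ik I1.
have [Im|] := pselect (maximal I); first by exists I.
move=> /not_andP[//|/existsNP[J /not_implyP[IJ /not_orP[JI J1]]]].
have [|P Pm JP] := IH J _ J1.
  rewrite ltnS in Ik; apply: leq_trans Ik.
  by apply: ideal_norm_lt => // E; apply: JI.
by exists P => // x /IJ /JP.
Qed.

Lemma not_coprime_maximal I J : ~ coprime_ideal I J ->
  exists P, [/\ maximal P, I `<=` P & J `<=` P].
Proof.
move=> nc; have [|P Pm sub] := @ex_maximal (idealD I J).
  move=> E; apply: nc; have : 1 \inI idealD I J by rewrite E.
  by move=> [x [y [Ix Jy e]]]; exists x, y.
exists P; split=> // x Ix; apply: sub; [exact: idealDl_sub|exact: idealDr_sub].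
Qed.

Lemma maximal_prod P (Ps : seq (nzideal D)) : maximal P ->
  foldr (@idealM D) (ideal1 D) Ps `<=` P -> exists2 Q, Q \in Ps & Q `<=` P.
Proof.
move=> Pm; elim: Ps => /= [h|Q Ps IH].
  by case: (Pm) => + _; case; apply: eq_ideal1; exact: h.
move=> /(maximal_prime Pm)[QP|/IH[Q' Q'Ps Q'P]].
  by exists Q; rewrite ?mem_head.
by exists Q' => //; rewrite inE Q'Ps orbT.
Qed.

Lemma foldr_idealM_sub Q (Ps : seq (nzideal D)) : Q \in Ps ->
  foldr (@idealM D) (ideal1 D) Ps `<=` Q.
Proof.
elim: Ps => //= P Ps IH; rewrite inE => /orP[/eqP->|/IH h] x.
  exact: idealMl_sub.
by move=> /idealMr_sub /h.
Qed.

(** The primes are treated one at a time: if [x] falls into [a P], it is corrected by an element of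
    [a] times the product of the other primes that is not in [a P]. Cancelling [a] shows that such
    an element exists. *)
Lemma ex_avoid a (Ps : seq (nzideal D)) : (forall P, P \in Ps -> maximal P) ->
  exists x, [/\ x != 0, x \inI a & forall P, P \in Ps -> ~ x \inI idealM a P].
Proof.
elim: Ps => [_|P Ps IH Psm].
  by have [x xa x0] := ideal_set_neq0 a; exists x.
have Pm : maximal P by apply: Psm; rewrite mem_head.
have Psm' Q : Q \in Ps -> maximal Q by move=> h; apply: Psm; rewrite inE h orbT.
have [x [x0 xa xPs]] := IH Psm'.
have [xP|xP] := pselect (x \inI idealM a P); last first.
  by exists x; split=> // Q; rewrite inE => /orP[/eqP->|/xPs].
have PPs : P \notin Ps by apply/negP => /xPs.
have [y ya yP] : exists2 y, y \inI idealM a (foldr (@idealM D) (ideal1 D) Ps)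
    & ~ y \inI idealM a P.
  apply: contrapT => no.
  have /idealM_subK/(maximal_prod Pm)[Q QPs QP] :
      idealM a (foldr (@idealM D) (ideal1 D) Ps) `<=` idealM a P.
    by move=> y ya; apply: contrapT => yP; apply: no; exists y.
  have [QP'|/(maximal_neq (Psm' _ QPs) Pm)//] := pselect (Q = P).
  by move: PPs; rewrite -QP' QPs.
exists (x + y); split.
- apply/eqP => xy0; apply: yP; suff -> : y = - x by exact: nzidealN.
  by apply/eqP; rewrite -addr_eq0 addrC xy0.
- by apply: nzidealD => //; exact: idealMl_sub ya.
- move=> Q; rewrite inE => /orP[/eqP-> xy|QPs xy].
    by apply: yP; rewrite -(addKr x y); apply: nzidealD => //; exact: nzidealN.
  apply: (xPs _ QPs); rewrite -(addrK y x); apply: nzidealB => //.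
  exact: idealMS (foldr_idealM_sub QPs) _ ya.
Qed.

(** An ideal containing [m] is determined by the residues modulo [m] that it contains. *)
Lemma finite_over m : finite_set [set I : nzideal D | m `<=` I].
Proof.
have [s [_ sP] _] := ex_complete_residues (finD m).
pose g (f : {ffun 'I_(size s) -> bool}) : nzideal D :=
  xget (ideal1 D) [set I : nzideal D | m `<=` I /\ forall i, f i = `[< s`_i \inI I >]].
apply: (@sub_finite_set _ _ (g @` setT)); last exact/finite_image/finite_finset.
move=> I mI; exists [ffun i : 'I_(size s) => `[< s`_i \inI I >]] => //.
rewrite /g; case: xgetP => [J _ [mJ JE]|/(_ I) []]; last first.
  by split=> // i; rewrite ffunE.
apply: nzideal_eq => x; have [y ys xy] := sP x.
have yE : y \inI J <-> y \inI I.
  have ys' : (index y s < size s)%N by rewrite index_mem.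
  have := JE (Ordinal ys'); rewrite ffunE /= nth_index // => E.
  by split=> /asboolP h; apply/asboolP; [rewrite E|rewrite -E].
split=> h.
- apply: (nzideal_subl (mI _ xy)); apply/yE.
  by apply: (nzideal_subl _ h); apply: nzideal_subC; exact: mJ.
- apply: (nzideal_subl (mJ _ xy)); apply/yE.
  by apply: (nzideal_subl _ h); apply: nzideal_subC; exact: mI.
Qed.

Lemma maximals_over m : exists2 Ps : seq (nzideal D), uniq Ps &
  forall P, P \in Ps <-> maximal P /\ m `<=` P.
Proof.
pose A := [set P | maximal P /\ m `<=` P].
have fA : finite_set A by apply: sub_finite_set (finite_over m) => P [].
exists (enum_fset (fset_set A)); first exact: fset_uniq.
by move=> P; rewrite in_fset_set //; split=> [/set_mem|] // h; apply/mem_set.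
Qed.

(** An [x] in [a] that avoids [a P] for every maximal [P] over [m] has a cofactor [c] contained in
    no such [P]. It serves as a generator of [a] modulo [a m]. *)
Lemma ex_coprime_principal a m : exists (x : D) (c : nzideal D),
  [/\ x != 0, pideal x = idealM a c & coprime_ideal c m].
Proof.
have [Ps _ PsP] := maximals_over m.
have [|x [x0 xa xPs]] := @ex_avoid a Ps; first by move=> P /PsP[].
have [c cE] := ideal_dvd (pideal_sub x0 xa); exists x, c; split=> //.
apply: contrapT => /not_coprime_maximal[P [Pm cP mP]].
apply: (xPs P); first exact/PsP.
by apply: (idealMS cP); rewrite -cE; exact: pideal_id.
Qed.

(** With [(x) = a c] and [c] prime to [m], multiplication by [x] induces a bijection from [D / m] to
    [a / a m]: [decomp] is its surjectivity, [cancel] its injectivity. Hence the sums [y + x * z]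
    form a residue system modulo [a m]. *)
Lemma ideal_normM a m : ideal_norm (idealM a m) = (ideal_norm a * ideal_norm m)%N.
Proof.
have [x [c [x0 xE cm]]] := ex_coprime_principal a m.
have xa : x \inI a by apply: (@idealMl_sub _ a c); rewrite -xE; exact: pideal_id.
have [u [v [uc vm uv]]] := cm.
have decomp y : y \inI a -> exists z, y - x * z \inI idealM a m.
  move=> ya; have : y * u \inI pideal x by rewrite xE; exact: idealM_in.
  move=> /(pidealP _ x0)[z zE]; exists z.
  rewrite -zE -{1}(mulr1 y) -mulrBr -uv addrAC subrr add0r; exact: idealM_in.
have cancel z : x * z \inI idealM a m -> z \inI m.
  have [->|z0] := eqVneq z 0; first by move=> _; exact: nzideal0.
  move=> xz; have : idealM c (pideal z) `<=` m.
    apply: (@idealM_subK a); rewrite idealMA -xE.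
    move=> _ /(pidealMP _ _ x0)[_ /(pidealP _ z0)[t ->] ->].
    by rewrite mulrA; exact: nzidealMr.
  move=> /(_ _ (idealM_in uc (pideal_id z))) uz.
  by rewrite -(mul1r z) -uv mulrDl; apply: nzidealD => //; exact: nzidealMr.
have [s [[us sI] sP] sN] := ex_complete_residues (finD a).
have [t [[ut tI] tP] tN] := ex_complete_residues (finD m).
rewrite -sN -tN.
have inj y z y' z' : y \in s -> y' \in s -> z \in t -> z' \in t ->
    y + x * z - (y' + x * z') \inI idealM a m -> y = y' /\ z = z'.
  move=> ys ys' zt zt'.
  have -> : y + x * z - (y' + x * z') = (y - y') + x * (z - z') by ring.
  move=> h; have E : y = y'.
    apply: sI => //; rewrite -(addrK (x * (z - z')) (y - y')); apply: nzidealB.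
      exact: idealMl_sub h.
    exact: nzidealMr.
  by split=> //; apply: tI => //; apply: cancel; move: h; rewrite E subrr add0r.
have [] := @complete_residues_norm _ (idealM a m) [seq y + x * z | y <- s, z <- t].
  split; last first.
    move=> w; have [y ys wy] := sP w; have [z wyz] := decomp _ wy.
    have [z' zt zz'] := tP z; exists (y + x * z'); first exact: allpairs_f.
    have -> : w - (y + x * z') = (w - y - x * z) + x * (z - z') by ring.
    by apply: nzidealD => //; exact: idealM_in.
  split.
    apply: allpairs_uniq => // -[y z] [y' z'] /allpairsP[[p q] [/= ps qt [-> ->]]].
    move=> /allpairsP[[p' q'] [/= ps' qt' [-> ->]]] /= E.
    have [|-> ->] // := inj p q p' q' ps ps' qt qt'.
    by rewrite E subrr; exact: nzideal0.
  move=> _ _ /allpairsP[[p q] [/= ps qt ->]] /allpairsP[[p' q'] [/= ps' qt' ->]].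
  by move=> /inj[]// -> ->.
by move=> _ ->; rewrite size_allpairs.
Qed.

Lemma ideal_norm1 : ideal_norm (ideal1 D) = 1%N.
Proof.
have [] := @complete_residues_norm _ (ideal1 D) [:: 0]; last by [].
by split=> [|x]; [split=> // x y; rewrite !inE => /eqP-> /eqP->|exists 0; rewrite ?inE].
Qed.

Lemma maximal_norm P : maximal P -> (1 < ideal_norm P)%N.
Proof.
by move=> [P1 _]; rewrite -ideal_norm1; apply: ideal_norm_lt.
Qed.

(** The primes are divided off one after another; a quotient by one of them still lies in the
    others. This limits how many large primes contain a given element. *)
Lemma maximal_norm_prod I (Ps : seq (nzideal D)) : uniq Ps ->
  (forall P, P \in Ps -> maximal P /\ I `<=` P) ->
  (\prod_(P <- Ps) ideal_norm P <= ideal_norm I)%N.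
Proof.
elim: Ps I => [|P Ps IH] I /=; first by rewrite big_nil ideal_norm_gt0.
move=> /andP[PPs uPs] h; rewrite big_cons.
have [Pm IP] := h P (mem_head _ _); have [M IE] := ideal_dvd IP.
rewrite IE ideal_normM leq_mul2l; apply/orP; right; apply: IH => // Q QPs.
have [Qm IQ] : maximal Q /\ I `<=` Q by apply: h; rewrite inE QPs orbT.
split=> //; move: IQ; rewrite IE => /(maximal_prime Qm)[|//].
move=> /(maximal_neq Pm Qm); case; apply/nesym => E.
by move: PPs; rewrite -E QPs.
Qed.

End Dedekind.

(** * Finite quotients of subrings of global fields *)

Lemma fraction_repr (A : idomainType) (x : {fraction A}) :
  exists a b : A, b != 0 /\ x = tofrac a / tofrac b.
Proof.
elim/quotW: x => r; exists (r : A * A).1, (r : A * A).2; have d0 := denom_ratioP r.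
split=> //; apply/eqP; rewrite eq_sym; apply/eqP.
have d0' : tofrac (r : A * A).2 != 0 by rewrite tofrac_eq0.
apply: (canLR (mulfK d0')); unlock tofrac.
rewrite -[RHS]FracField.pi_mul; apply/eqmodP.
rewrite /= FracField.equivfE /FracField.mulf !numden_Ratio ?mulf_neq0 ?oner_neq0//.
by rewrite !mulr1 mul1r mulrC.
Qed.

Lemma leq_expn2r m k e : (m <= k -> m ^ e <= k ^ e)%N.
Proof. by case: e => // e h; rewrite leq_exp2r. Qed.

(** * Coordinate boxes in a finite extension *)

Section Boxes.
Variables (A : idomainType) (K : fieldType) (j : {rmorphism A -> K}).
Variables (L : fieldExtType K) (sz : A -> nat).
Hypothesis j_inj : injective j.
Hypothesis j_frac : forall k : K, exists x y, y != 0 /\ k = j x / j y.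
Hypothesis szD : forall x y, (sz (x + y) <= sz x + sz y)%N.
Hypothesis szM : forall x y, (sz (x * y) <= sz x * sz y)%N.
Hypothesis sz0 : (sz 0%R <= 1)%N.
Hypothesis sz_count : forall B, exists2 s : seq A,
  (size s <= (2 * B).+1)%N & forall z, (sz z <= B)%N -> z \in s.

Let n := \dim {:L}.
Let co (i : 'I_n) (v : L) : K := coord (vbasis {:L}) i v.

(** Vectors whose coordinates have the common denominator [c] and numerators of size at most [B].
    The size will be the absolute value on the integers and [p ^ size f] on polynomials over
    ['F_p]. *)
Definition inbox (c : A) (B : nat) (v : L) :=
  forall i, exists2 z, (sz z <= B)%N & j c * co i v = j z.

Let jn0 c : c != 0 -> j c != 0.
Proof. by move=> c0; rewrite -(rmorph0 j) (inj_eq j_inj). Qed.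

Let co_inj u v : (forall i, co i u = co i v) -> u = v.
Proof.
move=> h; rewrite (coord_vbasis (memvf u)) (coord_vbasis (memvf v)).
by apply: eq_bigr => i _; congr (_ *: _); exact: h.
Qed.

Let coD i u v : co i (u + v) = co i u + co i v.
Proof. exact: raddfD. Qed.

Lemma inbox0 c B : (0 < B)%N -> inbox c B 0.
Proof.
move=> B0 i; exists 0; first exact: leq_trans sz0 B0.
by rewrite /co raddf0 mulr0 rmorph0.
Qed.

Lemma inbox_le c B B' v : (B <= B')%N -> inbox c B v -> inbox c B' v.
Proof. by move=> BB' h i; have [z zB e] := h i; exists z => //; exact: leq_trans BB'. Qed.

Lemma inboxD c B B' u v : inbox c B u -> inbox c B' v -> inbox c (B + B') (u + v).
Proof.
move=> hu hv i; have [y yB ye] := hu i; have [z zB ze] := hv i.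
exists (y + z); last by rewrite coD mulrDr ye ze rmorphD.
by apply: leq_trans (szD _ _) _; exact: leq_add.
Qed.

Lemma inboxZ c c' B v : inbox c B v -> inbox (c' * c) (sz c' * B) v.
Proof.
move=> hv i; have [z zB ze] := hv i; exists (c' * z).
  by apply: leq_trans (szM _ _) _; rewrite leq_mul2l zB orbT.
by rewrite !rmorphM -mulrA ze.
Qed.

Lemma inbox_count c B (s : seq L) : c != 0 -> uniq s ->
  (forall v, v \in s -> inbox c B v) -> (size s <= (2 * B).+2 ^ n)%N.
Proof.
move=> c0 us h; have [t tB tP] := sz_count B.
pose zf v i := xget 0 [set z | (sz z <= B)%N /\ j c * co i v = j z].
have zfP v i : v \in s -> (sz (zf v i) <= B)%N /\ j c * co i v = j (zf v i).
  move=> /h /(_ i)[z zB ze]; rewrite /zf; case: xgetP => [y _ []//|/(_ z) []].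
  by split.
(* [inord] needs a successor as bound; the spare value accounts for [.+2] in the statement. *)
pose phi v : {ffun 'I_n -> 'I_(size t).+1} := [ffun i => inord (index (zf v i) t)].
have inj : {in s &, injective phi}.
  move=> u v us' vs' /ffunP E; apply: co_inj => i.
  apply: (mulfI (jn0 c0)).
  have [uB ->] := zfP u i us'; have [vB ->] := zfP v i vs'; congr (j _).
  have := E i; rewrite !ffunE => /(congr1 (@nat_of_ord _)).
  rewrite !inordK ?ltnS ?index_size // => E'.
  by rewrite -(nth_index 0 (tP _ uB)) E' nth_index // tP.
rewrite -(size_map phi); have : uniq (map phi s) by rewrite map_inj_in_uniq.
move=> /card_uniqP <-; apply: leq_trans (max_card _) _.
by rewrite card_ffun !card_ord; exact: leq_expn2r.
Qed.

Lemma ex_denominator (T : finType) (f : T -> K) :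
  exists2 c, c != 0 & forall i, exists z, j c * f i = j z.
Proof.
have [x xP] := fin_all_exists (fun i => j_frac (f i)).
have [y yP] := fin_all_exists xP.
exists (\prod_i y i); first by rewrite prodf_seq_neq0; apply/allP => i _; have [] := yP i.
move=> i; exists (x i * \prod_(k | k != i) y k); have [y0 ->] := yP i.
rewrite (bigD1 i) //= !rmorphM; set P := j (\prod_(_ | _) _).
by field; exact: jn0.
Qed.

Lemma ex_inbox v : exists c B, [/\ c != 0, (0 < B)%N & inbox c B v].
Proof.
have [c c0 h] := ex_denominator (fun i => co i v).
have [z zP] := fin_all_exists h.
exists c, (\max_i sz (z i)).+1; split=> // i; exists (z i) => //.
by apply: leqW; exact: leq_bigmax.
Qed.

Lemma ex_inbox_seq (s : seq L) :
  exists c B, [/\ c != 0, (0 < B)%N & forall v, v \in s -> inbox c B v].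
Proof.
elim: s => [|v s [c [B [c0 B0 h]]]]; first by exists 1, 1%N; split=> //; exact: oner_neq0.
have [c' [B' [c0' B0' h']]] := ex_inbox v.
exists (c' * c), (sz c' * B + sz c * B').+1; split=> //; first by rewrite mulf_neq0.
move=> w; rewrite inE => /orP[/eqP->|/h hw].
  by apply: (@inbox_le _ (sz c * B')); [lia|rewrite mulrC; exact: inboxZ].
by apply: (@inbox_le _ (sz c' * B)); [lia|exact: inboxZ].
Qed.

(* Multiplication by [a] enlarges denominators by the factor [c0] and
   numerators by at most the factor [H]. *)
Definition bounded_by (a : L) (c0 : A) (H : nat) :=
  [/\ c0 != 0, (0 < H)%N & forall c B v, (0 < B)%N -> inbox c B v ->
    inbox (c0 * c) (H * B) v /\ inbox (c0 * c) (H * B) (a * v)].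

(** [c0] clears the denominators of the matrix of multiplication by [a], and [B0] bounds the
    numerators of its entries. *)
Lemma ex_bounded_by a : exists c0 H, bounded_by a c0 H.
Proof.
pose e i := (vbasis {:L})`_i.
have [c0 c00 h] := ex_denominator (fun ik : 'I_n * 'I_n => co ik.2 (a * e ik.1)).
have [z zP] := fin_all_exists h.
pose B0 := \max_ik sz (z ik).
(* [sz c0] serves the vector [v] itself, [n * B0] a sum of [n] products, and [1] the size of the
   empty sum. *)
exists c0, (sz c0 + n * B0 + 1)%N; split=> //; first by rewrite addn1.
move=> c B v B_gt0 hv; split.
  by apply: (inbox_le _ (inboxZ _ hv)); rewrite leq_mul2r; apply/orP; right; lia.
move=> k; have [y yB yE] := fin_all_exists2 hv.
exists (\sum_i z (i, k) * y i); last first.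
  rewrite {1}(coord_vbasis (memvf v)) mulr_sumr /co raddf_sum mulr_sumr rmorph_sum.
  apply: eq_bigr => i _ /=; rewrite -scalerAr linearZ /= !rmorphM -yE -(zP (i, k)) /=.
  by rewrite /co /e; ring.
apply: (@leq_trans (1 + \sum_(i < n) B0 * B)).
  have : forall (r : seq 'I_n), (sz (\sum_(i <- r) z (i, k) * y i)%R <= 1 + \sum_(i <- r) B0 * B)%N.
    elim=> [|i r IH]; first by rewrite !big_nil addn0.
    rewrite !big_cons addnCA; apply: leq_trans (szD _ _) _; apply: leq_add => //.
    apply: leq_trans (szM _ _) _; apply: leq_mul => //.
    exact: (leq_bigmax (F := fun ik => sz (z ik))).
  exact.
by rewrite sum_nat_const card_ord; nia.
Qed.

Lemma bounded_by_le a c0 H H' : (H <= H')%N -> bounded_by a c0 H -> bounded_by a c0 H'.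
Proof.
move=> HH [c00 H0 h]; split=> //; first exact: leq_trans HH.
move=> c B v B0 /(h _ _ _ B0)[h1 h2].
have le : (H * B <= H' * B)%N by rewrite leq_mul2r HH orbT.
by split; [exact: inbox_le h1|exact: inbox_le h2].
Qed.

Lemma bounded_byM a a' c c' H H' : bounded_by a c H -> bounded_by a' c' H' ->
  bounded_by (a * a') (c * c') (H * H').
Proof.
move=> [c0 H0 h] [c0' H0' h']; split; rewrite ?mulf_neq0 ?muln_gt0 ?H0//.
move=> d B v B0 /(h' _ _ _ B0)[h1 h2].
have B0' : (0 < H' * B)%N by rewrite muln_gt0 H0'.
have [h3 _] := h _ _ _ B0' h1; have [_ h4] := h _ _ _ B0' h2.
by rewrite -!mulrA -!mulnA.
Qed.

Lemma bounded_byD a a' c c' H H' : bounded_by a c H -> bounded_by a' c' H' ->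
  bounded_by (a + a') (c * c') (2 * (H * H')).
Proof.
move=> [c0 H0 h] [c0' H0' h']; split; rewrite ?mulf_neq0 ?muln_gt0 ?H0//.
move=> d B v B0 hv; have [h1 h2] := h' _ _ _ B0 hv; have [h5 h6] := h _ _ _ B0 hv.
have B0' : (0 < H' * B)%N by rewrite muln_gt0 H0'.
have B0'' : (0 < H * B)%N by rewrite muln_gt0 H0.
have [h3 _] := h _ _ _ B0' h1; have [h4 _] := h _ _ _ B0' h2.
have [h7 _] := h' _ _ _ B0'' h6.
rewrite -!mulrA -!mulnA; split; first by apply: inbox_le h3; lia.
rewrite mulrDl mul2n -addnn; apply: inboxD => //.
by rewrite mulrCA mulnCA.
Qed.

Lemma bounded_by_nat k : bounded_by k%:R 1 k.+1.
Proof.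
split=> // [|c B v B0 hv]; first exact: oner_neq0.
rewrite mul1r; split; first by apply: inbox_le hv; nia.
elim: k => [|k IH]; first by rewrite mul0r; apply: inbox0; lia.
rewrite mulrSr mulrDl mul1r; rewrite mulSn addnC; exact: inboxD.
Qed.

Variables (D : idomainType) (emb : D -> L).
Hypothesis emb_inj : injective emb.
Hypothesis embD : {morph emb : x y / x + y}.
Hypothesis embM : {morph emb : x y / x * y}.

(* Distinct words [\sum_(i < m) a ^+ i * s_i] in a set [s] of representatives
   modulo [a] have distinct values, and these values lie in a box of size
   exponential in [m]. *)
Lemma incongruent_pideal_bound a c0 H (s : seq D) : a != 0 ->
  bounded_by (emb a) c0 H -> incongruent (pideal a) s ->
  (size s <= 2 * (2 * H) ^ n)%N.
Proof.
move=> a0 bd [us sI]; have [c00 H0 bdP] := bd.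
have [c [B [cn0 B0 sB]]] := ex_inbox_seq [seq emb x | x <- s].
pose fix W m := if m is m'.+1 then [seq x + a * w | x <- s, w <- W m'] else [:: 0 : D].
have sizeW m : size (W m) = (size s ^ m)%N.
  by elim: m => //= m IH; rewrite size_allpairs IH expnS.
(* The value of a word determines its first letter modulo [a], and the remaining word after
   cancelling [a]. *)
have uW m : uniq (W m).
  elim: m => //= m IH; apply: allpairs_uniq => // -[x w] [x' w'].
  move=> /allpairsP[[p q] [/= ps qW [-> ->]]] /allpairsP[[p' q'] [/= ps' qW' [-> ->]]] /= E.
  have pp' : p = p'.
    apply: sI => //; apply/(pidealP _ a0); exists (q' - q).
    by apply/eqP; rewrite mulrBr -subr_eq0 -(subrr (p' + a * q')) -{1}E; apply/eqP; ring.
  congr (_, _) => //; move: E; rewrite pp' => /addrI /(mulfI a0) //.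
have boxs m x : x \in s -> inbox (c0 ^+ m * c) (H ^ m * B) (emb x).
  elim: m => [|m IH] xs; first by rewrite mul1r mul1n; apply: sB; exact: map_f.
  have B0m : (0 < H ^ m * B)%N by rewrite muln_gt0 expn_gt0 H0.
  by have [h _] := bdP _ _ _ B0m (IH xs); rewrite exprS expnS -mulrA -mulnA.
have boxW m w : w \in W m -> inbox (c0 ^+ m * c) ((2 * H) ^ m * B) (emb w).
  elim: m w => [|m IH] w /=.
    rewrite inE => /eqP ->; have -> : emb 0 = 0.
      by apply: (addrI (emb 0)); rewrite -embD !addr0.
    by rewrite mul1r mul1n; exact: inbox0.
  move=> /allpairsP[[x w'] [/= xs wW ->]]; rewrite embD embM.
  have B0m : (0 < (2 * H) ^ m * B)%N by rewrite muln_gt0 expn_gt0 muln_gt0 H0.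
  have [_] := bdP _ _ _ B0m (IH _ wW); rewrite mulrA -exprS => h.
  apply: inbox_le (inboxD (boxs m.+1 x xs) h).
  have le : (H ^ m <= (2 * H) ^ m)%N by apply: leq_expn2r; lia.
  have : (H * H ^ m * B <= H * (2 * H) ^ m * B)%N by rewrite leq_mul2r leq_mul2l le !orbT.
  rewrite !expnS; set X := (H * H ^ m * B)%N; lia.
(* There are [size s ^ m] words in a box of at most [C * G ^ m] points; [size s > 2 * G] would give
   [2 ^ m <= C] for all [m]. *)
rewrite leqNgt; apply/negP => ltK; set G := ((2 * H) ^ n)%N in ltK.
have G0 : (0 < G)%N by rewrite expn_gt0 muln_gt0 H0.
pose C := ((4 * B) ^ n)%N.
have main m : (2 ^ m <= C)%N.
  have : (size s ^ m <= (2 * ((2 * H) ^ m * B)).+2 ^ n)%N.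
    rewrite -sizeW -(size_map emb); apply: (inbox_count (c := c0 ^+ m * c)).
    - by rewrite mulf_neq0 ?expf_neq0.
    - by rewrite map_inj_uniq.
    - by move=> _ /mapP[w wW ->]; exact: boxW.
  move=> le1; have le2 : ((2 * G) ^ m <= C * G ^ m)%N.
    apply: leq_trans (leq_expn2r _ (ltnW ltK)) (leq_trans le1 _).
    rewrite /C /G -expnM (mulnC n m) expnM -expnMn; apply: leq_expn2r.
    have : (0 < (2 * H) ^ m)%N by rewrite expn_gt0 muln_gt0 H0.
    by nia.
  by move: le2; rewrite expnMn leq_pmul2r // expn_gt0 G0.
by have := leq_ltn_trans (main C) (ltn_expl C (ltnSn 1)); rewrite ltnn.
Qed.

Lemma pideal_norm_bound a c0 H : a != 0 -> bounded_by (emb a) c0 H ->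
  finite_residue (pideal a) /\ (ideal_norm (pideal a) <= 2 * (2 * H) ^ n)%N.
Proof.
by move=> a0 bd; apply: incongruent_bound => s; exact: incongruent_pideal_bound bd.
Qed.

Lemma finite_quotients (I : nzideal D) : finite_residue I.
Proof.
have [a aI a0] := ideal_set_neq0 I; have [c0 [H bd]] := ex_bounded_by (emb a).
have [fa _] := pideal_norm_bound a0 bd.
by have [] := finite_residue_sub (pideal_sub a0 aI) fa.
Qed.

End Boxes.

(* At most [C * 2 ^ f] elements, of norm exponential in [f], meet every ideal of
   norm below [2 ^ f.+1]; so [O(2 ^ f)] primes have norm between [2 ^ f] and [2 ^ f.+1]. *)
Definition small_elements (D : idomainType) := exists C h : nat, forall f, (0 < f)%N ->
  exists E : seq D, [/\ (size E <= C * 2 ^ f)%N,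
    forall g, g \in E -> g != 0 /\ (ideal_norm (pideal g) <= 2 ^ (h * f))%N &
    forall I : nzideal D, (ideal_norm I < 2 ^ f.+1)%N -> exists2 g, g \in E & g \inI I].

Lemma norm_pigeonhole (D : idomainType) (I : nzideal D) (s : seq D) :
  finite_residue I -> uniq s -> (ideal_norm I < size s)%N ->
  exists x y, [/\ x \in s, y \in s, x != y & x - y \inI I].
Proof.
move=> fI us; rewrite ltnNge => /negP lt; apply: contrapT => no; apply: lt.
apply: incongruent_leq_norm => //; split=> // x y xs ys xy; apply: contrapT => /eqP neq.
by apply: no; exists x, y.
Qed.

Section Morphism.
Variables (D : idomainType) (L : fieldType) (emb : D -> L).
Hypothesis embD : {morph emb : x y / x + y}.
Hypothesis emb1 : emb 1 = 1.

Lemma morph_nat k : emb k%:R = k%:R.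
Proof.
have emb0 : emb 0 = 0 by apply: (addrI (emb 0)); rewrite -embD !addr0.
by elim: k => [|k IH]; rewrite ?emb0// !mulrSr embD IH emb1.
Qed.
End Morphism.

(** * Number fields *)

Section NumberField.
Variables (D : idomainType) (L : fieldExtType rat) (emb : D -> L).
Hypothesis emb_inj : injective emb.
Hypothesis embD : {morph emb : x y / x + y}.
Hypothesis embM : {morph emb : x y / x * y}.
Hypothesis emb1 : emb 1 = 1.

Let int_count B : exists2 s : seq int,
  (size s <= (2 * B).+1)%N & forall z, (absz z <= B)%N -> z \in s.
Proof.
exists ([seq Posz k | k <- iota 0 B.+1] ++ [seq - (Posz k) | k <- iota 1 B]).
  by rewrite size_cat !size_map !size_iota; lia.
move=> z zB; rewrite mem_cat; case: z zB => k kB; apply/orP; [left|right].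
  by apply: map_f; rewrite mem_iota.
by rewrite NegzE; apply: (map_f (fun k => - Posz k)); rewrite mem_iota; move: kB; rewrite /=; lia.
Qed.

Let int_frac (k : rat) : exists x y : int, y != 0 /\ k = x%:~R / y%:~R.
Proof. by exists (numq k), (denq k); rewrite divq_num_den denq_neq0. Qed.

Let int_szD (x y : int) : (absz (x + y)%R <= absz x + absz y)%N.
Proof. lia. Qed.

Let int_szM (x y : int) : (absz (x * y)%R <= absz x * absz y)%N.
Proof. by rewrite abszM. Qed.

Let int_sz0 : (absz 0%R <= 1)%N. Proof. by []. Qed.

Lemma number_field_finite_quotients I : @finite_residue D I.
Proof.
exact: (finite_quotients (@intr_inj rat) int_frac int_szD int_szM int_sz0 int_count
  emb_inj embD embM).
Qed.

(** The elements are the integers from [1] to [2 ^ f.+1]: among [0, ..., ideal_norm I] two are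
    congruent modulo [I], and their difference is one of these integers. *)
Lemma number_field_small_elements : small_elements D.
Proof.
pose n := \dim {:L}.
have nat0 k : k%:R = 0 :> D -> k = 0%N.
  move=> k0; have : (k%:R : L) = 0 by rewrite -(morph_nat embD emb1) k0; exact: (morph_nat embD emb1 0).
  rewrite -scaler_nat => /eqP; rewrite scaler_eq0 oner_eq0 orbF.
  by rewrite pnatr_eq0 => /eqP.
have nat_inj : injective (fun k : nat => k%:R : D).
  move=> k l /= E; wlog kl : k l E / (k <= l)%N.
    by move=> H; case: (leqP k l) => [/H->//|/ltnW /H ->].
  by have := nat0 (l - k)%N; rewrite natrB // E subrr => /(_ erefl); lia.
(* The norm of [(k)] is at most [2 * (2 * k.+1) ^ n], hence at most [2 ^ (1 + (f + 3) * n)]. *)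
exists 2%N, (1 + 4 * n)%N => f f0; exists [seq k%:R | k <- iota 1 (2 ^ f.+1)]; split.
- by rewrite size_map size_iota expnS.
- move=> g /mapP[k + ->]; rewrite mem_iota => /andP[k0 kle].
  have kn0 : k%:R != 0 :> D by apply/eqP => /nat0; lia.
  split=> //.
  have bd : bounded_by intr absz (emb k%:R) 1 k.+1.
    by rewrite (morph_nat embD emb1); exact: bounded_by_nat.
  have [_ le] := pideal_norm_bound (@intr_inj rat) int_frac int_szD int_szM int_sz0 int_count
    emb_inj embD embM kn0 bd.
  apply: (leq_trans le); rewrite -/n.
  apply: (@leq_trans (2 * (2 ^ (f + 3)) ^ n)).
    rewrite leq_mul2l /=; apply: leq_expn2r.
    by rewrite expnD; move: kle; rewrite expnS; lia.
  rewrite -expnM -expnS leq_exp2l //; nia.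
- move=> I Ilt; have [|||x [y []]] := @norm_pigeonhole D I [seq k%:R | k <- iota 0 (ideal_norm I).+1].
  + exact: number_field_finite_quotients.
  + by rewrite map_inj_uniq // iota_uniq.
  + by rewrite size_map size_iota.
  + move=> /mapP[k + ->] /mapP[l + ->]; rewrite !mem_iota /= !add0n => kle lle.
    move=> neq; have kl : k <> l by move=> kl; rewrite kl eqxx in neq.
    move=> kI; wlog lk : k l kle lle {neq} kl kI / (l < k)%N.
      move=> H; case: (ltngtP l k) => [h|h|h]; last by rewrite h in kl.
        by apply: (H k l).
      by apply: (H l k) => //; [exact: nesym|exact: nzideal_subC].
    exists (k - l)%:R; last by rewrite natrB // ltnW.
    by apply: map_f; rewrite mem_iota; lia.
Qed.

End NumberField.

(** * Function fields *)

Section FunctionField.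
Variables (p : nat) (p_pr : prime p).
Variables (D : idomainType) (L : fieldExtType {fraction {poly 'F_p}}) (emb : D -> L).
Hypothesis emb_inj : injective emb.
Hypothesis embD : {morph emb : x y / x + y}.
Hypothesis embM : {morph emb : x y / x * y}.
Hypothesis emb1 : emb 1 = 1.
Hypothesis emb_frac : forall z : L, exists a b, z = emb a / emb b.

Let A := {poly 'F_p}.
Let K := {fraction A}.
Let sz (f : A) := (p ^ size f)%N.
Let j : {rmorphism A -> K} := @tofrac A.
Let n := \dim {:L}.

Let j_inj : injective j. Proof. by move=> x y /eqP; rewrite tofrac_eq => /eqP. Qed.
Let j_frac : forall k : K, exists x y, y != 0 /\ k = j x / j y.
Proof. exact: fraction_repr. Qed.
Let p_gt1 : (1 < p)%N := prime_gt1 p_pr.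

Let szD (x y : A) : (sz (x + y)%R <= sz x + sz y)%N.
Proof.
apply: (@leq_trans (p ^ maxn (size x) (size y))); first by rewrite leq_exp2l // size_polyD.
by rewrite /sz; case: (leqP (size x) (size y)) => _; [exact: leq_addl|exact: leq_addr].
Qed.

Let szM (x y : A) : (sz (x * y)%R <= sz x * sz y)%N.
Proof.
rewrite -expnD leq_exp2l //; apply: leq_trans (size_polyMleq _ _) _; exact: leq_pred.
Qed.

Let sz0 : (sz 0%R <= 1)%N. Proof. by rewrite /sz size_poly0. Qed.

Let sz_count B : exists2 s : seq A,
  (size s <= (2 * B).+1)%N & forall z, (sz z <= B)%N -> z \in s.
Proof.
pose k := trunc_log p B; exists [seq rVpoly v | v : 'rV['F_p]_k].
  rewrite size_map -cardE card_mx card_Fp // mul1n.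
  rewrite /k; have [->|B0] := posnP B; first by rewrite trunc_log0.
  by apply: leq_trans (trunc_logP p_gt1 B0) _; lia.
move=> z zB; have zk : (size z <= k)%N.
  by apply: trunc_log_max.
by apply/mapP; exists (poly_rV z); rewrite ?mem_enum // poly_rV_K.
Qed.

Lemma function_field_finite_quotients I : @finite_residue D I.
Proof. exact: (finite_quotients j_inj j_frac szD szM sz0 sz_count emb_inj embD embM). Qed.

Let base : {rmorphism 'F_p -> L} := in_alg L \o (j \o polyC).

(** If [D] were algebraic over ['F_p], so would be all quotients of its elements, that is [L], which
    contains the indeterminate. *)
Lemma ex_transcendental : exists y : D, ~ algebraicOver base (emb y).
Proof.
apply: contrapT => /forallNP no.
have alg (z : L) : algebraicOver base z.
  by have [a [b ->]] := emb_frac z; apply: algebraic_div; apply: contrapT; exact: no.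
have [q q0] := alg (in_alg L (j 'X)).
rewrite (map_poly_comp (in_alg L) (j \o polyC)) rootE horner_map fmorph_eq0.
rewrite (map_poly_comp j polyC) horner_map /= tofrac_eq0.
by rewrite -[X in X != _]comp_polyXr in q0; rewrite (negPf q0).
Qed.

(** Horner evaluation at [y] of the polynomial with coefficients [s]; the coefficients enter as
    natural numbers, so [D] need not carry an algebra structure over ['F_p]. *)
Let val (y : D) (s : seq 'F_p) : D := foldr (fun (x : 'F_p) (acc : D) => (x : nat)%:R + y * acc) 0 s.

Let emb0 : emb 0 = 0. Proof. exact: (morph_nat embD emb1 0). Qed.

Let emb_val y (s : seq 'F_p) : emb (val y s) = (map_poly base (Poly s)).[emb y].
Proof.
elim: s => [|x s IH] /=; first by rewrite emb0 rmorph0 horner0.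
rewrite embD embM (morph_nat embD emb1) IH cons_poly_def rmorphD rmorphM /=.
rewrite map_polyX map_polyC !hornerE addrC mulrC; congr (_ + _).
by rewrite -(rmorph_nat base) natr_Zp.
Qed.

(** Each step of Horner's scheme costs one factor [2 * (p.+1 * H)]. *)
Let value_bounded y c0 H (s : seq 'F_p) : bounded_by j sz (emb y) c0 H ->
  exists c, bounded_by j sz (emb (val y s)) c ((2 * (p.+1 * H)) ^ size s).
Proof.
move=> bd; elim: s => [|x s [c IH]] /=.
  by exists 1; rewrite emb0; exact: (bounded_by_nat j L szD sz0 0).
exists (1 * (c0 * c)); rewrite embD embM (morph_nat embD emb1).
have bx := bounded_by_nat j L szD sz0 x.
have xp : (x < p)%N by have := ltn_ord x; rewrite [X in (_ < X)%N]Fp_cast.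
have := bounded_byD szD sz0 (bounded_by_le (leqW xp : (x.+1 <= p.+1)%N) bx) (bounded_byM bd IH).
by rewrite expnS !mulnA.
Qed.

(** Polynomials of size at most [k] at a transcendental [y] replace the integers of the number field
    case, with [p ^ k] just above [2 ^ f.+1]. Differences of such values are again such values. *)
Lemma function_field_small_elements : small_elements D.
Proof.
have [y ytr] := ex_transcendental.
have [c0 [H bd]] := ex_bounded_by j_inj j_frac szD szM sz0 (emb y).
pose G := (2 * (p.+1 * H))%N.
(* The first constant comes from [p ^ k <= p * 2 ^ f.+1]. The second comes from [k <= 3 * f] and
   [G <= 2 ^ G], which bound the norm by [2 * (2 * 2 ^ (G * (3 * f))) ^ n]. *)
exists (2 * p)%N, (1 + n * (1 + 3 * G))%N => f f0.
pose k := (trunc_log p (2 ^ f.+1)).+1.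
have klow : (2 ^ f.+1 < p ^ k)%N by exact: trunc_log_ltn.
have kup : (p ^ k <= p * 2 ^ f.+1)%N.
  by rewrite [(p ^ k)%N]expnS leq_mul2l trunc_logP ?orbT ?expn_gt0.
have kf : (k <= 3 * f)%N.
  have : (k.-1 <= f.+1)%N.
    rewrite -(leq_exp2l (m := 2)) //; apply: leq_trans (trunc_logP p_gt1 _); last first.
      by rewrite expn_gt0.
    exact: leq_expn2r.
  by rewrite /=; lia.
pose V (v : 'rV['F_p]_k) := val y (rVpoly v).
have embV v : emb (V v) = (map_poly base (rVpoly v)).[emb y].
  by rewrite emb_val polyseqK.
have V_inj : injective V.
  move=> v w /(congr1 emb); rewrite !embV => /eqP E; apply: contrapT => /eqP vw.
  apply: ytr; exists (rVpoly v - rVpoly w); last first.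
    by rewrite /root rmorphB /= hornerD hornerN subr_eq0.
  rewrite subr_eq0; apply: contraNneq vw => E'.
  by rewrite -(rVpolyK v) -(rVpolyK w) E'.
have VB v w : V v - V w = V (v - w).
  apply: (emb_inj); apply: (addIr (emb (V w))); rewrite -embD subrK !embV.
  by rewrite -hornerD -rmorphD /= raddfB subrK.
have sE : size [seq V v | v : 'rV['F_p]_k] = (p ^ k)%N.
  by rewrite size_map -cardE card_mx card_Fp // mul1n.
exists [seq w <- [seq V v | v : 'rV['F_p]_k] | w != 0]; split.
- rewrite size_filter; apply: leq_trans (count_size _ _) _; rewrite sE.
  by apply: leq_trans kup _; rewrite expnS; lia.
- move=> w; rewrite mem_filter => /andP[w0 /mapP[v _ wE]]; split=> //; subst w.
  have [c bv] := value_bounded (rVpoly v) bd.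
  have [_ le] := pideal_norm_bound j_inj j_frac szD szM sz0 sz_count
    emb_inj embD embM w0 bv.
  apply: (leq_trans le); rewrite -/n -/G.
  have sv : (size (rVpoly v) <= 3 * f)%N by apply: leq_trans (size_poly _ _) kf.
  apply: (@leq_trans (2 * (2 * 2 ^ (G * (3 * f))) ^ n)).
    rewrite leq_mul2l /=; apply: leq_expn2r; rewrite leq_mul2l /=.
    apply: (@leq_trans ((2 ^ G) ^ size (rVpoly v))).
      by apply: leq_expn2r; apply: ltnW; exact: ltn_expl.
    by rewrite -expnM leq_exp2l // leq_mul2l sv orbT.
  rewrite -expnS -expnM -expnS leq_exp2l //; nia.
- move=> I Ilt; have [|||x [z []]] := @norm_pigeonhole D I [seq V v | v : 'rV['F_p]_k].
  + exact: function_field_finite_quotients.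
  + by rewrite map_inj_uniq // enum_uniq.
  + by rewrite sE (ltn_trans Ilt).
  + move=> /mapP[v _ ->] /mapP[w _ ->] vw; rewrite VB => vwI; exists (V (v - w)) => //.
    rewrite mem_filter; apply/andP; split; last by apply: map_f; rewrite mem_enum.
    by rewrite -VB subr_eq0.
Qed.

End FunctionField.

Lemma global_field_finite_quotients_small (D : idomainType) : global_field {fraction D} ->
  (forall I : nzideal D, finite_residue I) /\ small_elements D.
Proof.
have key (K : fieldType) (L : fieldExtType K) (f : {rmorphism L -> {fraction D}}) :
    bijective f -> exists emb : D -> L, [/\ injective emb,
      {morph emb : x y / x + y}, {morph emb : x y / x * y}, emb 1 = 1 &
      forall z : L, exists a b, z = emb a / emb b].
  move=> [g fK gK]; exists (fun d => g (tofrac d)); split.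
  - by move=> x y /(can_inj gK)/eqP; rewrite tofrac_eq => /eqP.
  - by move=> x y; apply: (can_inj fK); rewrite /= (rmorphD f) !gK tofracD.
  - by move=> x y; apply: (can_inj fK); rewrite /= (rmorphM f) !gK tofracM.
  - by apply: (can_inj fK); rewrite /= (rmorph1 f) gK tofrac1.
  - move=> z; have [a [b [_ E]]] := fraction_repr (f z); exists a, b.
    by apply: (can_inj fK); rewrite /= (fmorph_div f) !gK.
case=> [[L [f /key[emb [inj eD eM e1 _]]]]|[p p_pr [L [f /key[emb [inj eD eM e1 efr]]]]]].
  by split; [exact: number_field_finite_quotients inj eD eM
            |exact: number_field_small_elements inj eD eM e1].
by split; [exact: (function_field_finite_quotients p_pr inj eD eM)
          |exact: (function_field_small_elements p_pr inj eD eM e1 efr)].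
Qed.

(** * Complete integral closedness and the algebra of the completion *)

(** For [q > 1], Bernoulli's inequality makes [q ^+ k] at least [k * (q - 1)], which is
    unbounded. *)
Lemma ler_prod_exp_bounded (R : realType) (u q : R) : 0 < u ->
  (forall k, u * q ^+ k <= 1) -> q <= 1.
Proof.
move=> u0 h; rewrite leNgt; apply/negP => q1.
have bern k : k%:R * (q - 1) <= q ^+ k.
  elim: k => [|k IH]; first by rewrite mul0r expr0 ler01.
  rewrite exprS -[in X in _ <= X](subrK 1 q) mulrDl mul1r mulrSr mulrDl mul1r addrC.
  apply: lerD; rewrite ?subrK// ler_peMr ?subr_ge0 ?(ltW q1)//.
  by rewrite exprn_ege1 // ltW.
have q0 : 0 < q - 1 by rewrite subr_gt0.
have := archi_boundP (ltW (divr_gt0 ltr01 (mulr_gt0 u0 q0))).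
set k := Num.bound _ => hk; have := h k; rewrite leNgt => /negP; apply.
apply: (@lt_le_trans _ _ (u * (k%:R * (q - 1)))); last by rewrite ler_pM2l.
by rewrite mulrCA mulrC -ltr_pdivrMl ?mulr_gt0// mulr1 -div1r.
Qed.

(* An absolute value bounded by [1] on [D] is bounded by [1] on every element
   all of whose powers have a common denominator in [D]. *)
Lemma global_dedekind_cic (R : realType) (D : idomainType) :
  global_dedekind_domain R D -> completely_integrally_closed D.
Proof.
move=> [_ [S [_ _ _ _ DS]]] b c y c0 y0 cy.
pose x : {fraction D} := tofrac b / tofrac c.
have c0' : tofrac c != 0 by rewrite tofrac_eq0.
have yE k : tofrac (y k) = x ^+ k * tofrac (y 0%N).
  elim: k => [|k IH]; first by rewrite mul1r.
  rewrite exprS -mulrA -IH /x mulrAC -tofracM -cy tofracM mulrAC divff ?mul1r//.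
have [d dE] : exists d, x = tofrac d.
  apply/DS => v vp vS f vf.
  have [f0 [_ _ vE]] := vp; move: (vf); rewrite vE => -[[fge feq0 fM _] _].
  have fD d : f (tofrac d) <= 1 by exact: ((DS (tofrac d)).1 (ex_intro _ d erefl) v vp vS f vf).
  have f1 : f 1 = 1.
    have f1n : f 1 != 0 by apply/eqP => /feq0/eqP; rewrite oner_eq0.
    by apply: (mulfI f1n); rewrite -fM !mulr1.
  have fX k : f (x ^+ k) = f x ^+ k by elim: k => [|k IH]; rewrite ?expr0// !exprS fM IH.
  apply: (@ler_prod_exp_bounded _ (f (tofrac (y 0%N)))).
    rewrite lt_neqAle fge andbT eq_sym; apply/eqP => /feq0/eqP.
    by rewrite tofrac_eq0 (negPf y0).
  by move=> k; rewrite -fX -fM mulrC -yE.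
exists d; apply/eqP; rewrite -tofrac_eq tofracM -dE /x mulrC divfK //.
Qed.

Section Completion.
Variable D : idomainType.
Hypothesis finD : forall I : nzideal D, finite_residue I.
Hypothesis cicD : completely_integrally_closed D.
Implicit Types (a b n : nzideal D) (c d : D).
Local Notation Dhat := (profinite_completion D).
Implicit Types (x y z : Dhat).

Lemma embedD c d : embed (c + d) = embed c + embed d.
Proof. by apply: component_inj => a; rewrite componentD -to_residueD. Qed.
Lemma embedM c d : embed (c * d) = embed c * embed d.
Proof. by apply: component_inj => a; rewrite componentM -to_residueM. Qed.
Lemma embed0 : embed 0 = 0 :> Dhat.
Proof. by apply: component_inj => a; exact: to_residue0. Qed.
Lemma to_residue_eq0 a d : to_residue a d = 0 <-> d \inI a.
Proof. by rewrite -to_residue0; split=> [/to_residueP|h]; [|apply/to_residueP]; rewrite subr0. Qed.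

Definition component_ker a : set Dhat := [set x | component x a = 0].

Lemma component_ker_ideal a : is_ideal (component_ker a).
Proof.
split=> [//|x y xa ya|r x xa].
- by change (component x a + component y a = 0); rewrite xa ya addr0.
- by change (component r a * component x a = 0); rewrite xa mulr0.
Qed.

Lemma extended_ideal_sub a : extended_ideal a `<=` component_ker a.
Proof.
apply: smallest_sub; first exact: component_ker_ideal.
by move=> _ [d da <-]; apply/to_residue_eq0.
Qed.

(** The component of [x] at [b] is read off at [c b], where [c * d] in [c b] forces [d] into [b]. *)
Lemma embed_torsion_free c x : c != 0 -> embed c * x = 0 -> x = 0.
Proof.
move=> c0 cx; apply: component_inj => b.
have [d dE] := to_residue_surj (component x (idealM (pideal c) b)).
rewrite (componentP (@idealMr_sub _ _ _) dE); apply/to_residue_eq0.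
have : component (embed c * x) (idealM (pideal c) b) = 0 by rewrite cx.
rewrite componentM dE component_embed -to_residueM => /to_residue_eq0.
by move=> /(pidealMP _ _ c0)[e eb /(mulfI c0) ->].
Qed.

Lemma embedI c x y : c != 0 -> embed c * x = embed c * y -> x = y.
Proof.
move=> c0 /eqP; rewrite -subr_eq0 -mulrBr => /eqP /(embed_torsion_free c0)/eqP.
by rewrite subr_eq0 => /eqP.
Qed.

(** At [c b] the component of [z] is some [c * e], with [e] unique modulo [b]; these [e] are the
    components of the quotient. *)
Lemma embed_divides c z : c != 0 -> component_ker (pideal c) z ->
  exists y, embed c * y = z.
Proof.
move=> c0 zc.
have ex b : exists e, component z (idealM (pideal c) b) = to_residue _ (c * e).
  have [d dE] := to_residue_surj (component z (idealM (pideal c) b)).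
  have := componentP (@idealMl_sub _ (pideal c) b) dE; rewrite zc => /esym/to_residue_eq0.
  by move=> /(pidealP _ c0)[e de]; exists e; rewrite -de.
have [e eP] := choice ex.
have comp : @compatible_families D (fun b => to_residue b (e b)).
  move=> b1 b2 b12 d /to_residueP ed.
  apply/to_residueP; apply: (@nzideal_trans _ _ _ (e b1)); last exact: b12.
  have := componentP (@idealMS _ (pideal c) _ _ b12) (eP b1).
  rewrite eP => /to_residueP; rewrite -mulrBr => /(pidealMP _ _ c0)[t tb].
  by move=> /(mulfI c0) ->.
exists (mk_profinite comp); apply: component_inj => b.
rewrite componentM component_embed -to_residueM.
by rewrite (componentP (@idealMr_sub _ (pideal c) b) (eP b)).
Qed.

(** Let [a a' = (c)]. For [al] in [a] and [ga] in [a'], [ga * x] is some [c * y], so [al * ga * x]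
    is [c] times an element of [a Dhat]. Summing such products gives [c * x], and [c] cancels. *)
Lemma component_ker_sub a : component_ker a `<=` extended_ideal a.
Proof.
move=> x xa K [hK aK]; have [a' [c [c0 E]]] := ideal_invertible finD cicD a.
have [K0 KD KM] := hK.
suff /(_ c (pideal_id c))[w Kw /(embedI c0) <-] : pideal c `<=`
  [set z | exists2 w, K w & embed c * w = embed z * x] by [].
rewrite -E; apply: idealM_ind.
  split=> [|z t [w Kw wE] [v Kv vE]|r z [w Kw wE]].
  - by exists 0 => //; rewrite mulr0 embed0 mul0r.
  - by exists (w + v); [exact: KD|rewrite mulrDr wE vE embedD mulrDl].
  - by exists (embed r * w); [exact: KM|rewrite mulrCA wE embedM mulrA].
move=> al ga ala gaa'.
have [y yE] : exists y, embed c * y = embed ga * x.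
  apply: embed_divides => //.
  change (to_residue (pideal c) ga * component x (pideal c) = 0).
  have [d dE] := to_residue_surj (component x (pideal c)).
  have ca : pideal c `<=` a by rewrite -E; exact: idealMl_sub.
  have da : d \inI a by apply/to_residue_eq0; rewrite -(componentP ca dE).
  rewrite dE -to_residueM; apply/to_residue_eq0; rewrite -E mulrC; exact: idealM_in.
exists (y * embed al); first by apply: KM; apply: aK; exists al.
by rewrite mulrA yE embedM mulrC mulrA.
Qed.

Lemma extended_idealE a : extended_ideal a = component_ker a.
Proof. by apply/seteqP; split; [exact: extended_ideal_sub|exact: component_ker_sub]. Qed.

Lemma extended_ideal_embed a d : extended_ideal a (embed d) <-> d \inI a.
Proof. by rewrite extended_idealE; exact: to_residue_eq0. Qed.

Lemma extended_ideal_le a b : extended_ideal a `<=` extended_ideal b <-> a `<=` b.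
Proof.
split=> [h d da|ab x].
  exact: ((extended_ideal_embed b d).1 (h _ ((extended_ideal_embed a d).2 da))).
rewrite !extended_idealE => xa; have [d dE] := to_residue_surj (component x a).
have : component x a = 0 by exact: xa.
rewrite dE => /to_residue_eq0 /ab bd; change (component x b = 0).
by rewrite (componentP ab dE); apply/to_residue_eq0.
Qed.

Lemma extended_ideal_cap a b :
  extended_ideal a `&` extended_ideal b = extended_ideal (idealI a b).
Proof.
have abl : idealI a b `<=` a by move=> ? [].
have abr : idealI a b `<=` b by move=> ? [].
rewrite !extended_idealE; apply/seteqP; split=> x;
  have [d dE] := to_residue_surj (component x (idealI a b)).
- move=> [xa xb]; change (component x (idealI a b) = 0); rewrite dE.
  apply/to_residue_eq0; split; apply/to_residue_eq0.
    by rewrite -(componentP abl dE).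
  by rewrite -(componentP abr dE).
- move=> xab; have : component x (idealI a b) = 0 by exact: xab.
  rewrite dE => /to_residue_eq0[da db]; split.
    by change (component x a = 0); rewrite (componentP abl dE); apply/to_residue_eq0.
  by change (component x b = 0); rewrite (componentP abr dE); apply/to_residue_eq0.
Qed.

(** A sequence that is eventually constant modulo every ideal has its eventual residues as a
    compatible family. *)
Lemma profinite_limit (s : nat -> D) :
  (forall m : nzideal D, exists k, forall l, (k <= l)%N -> s l - s k \inI m) ->
  exists x, forall m, exists k, forall l, (k <= l)%N -> component x m = to_residue m (s l).
Proof.
move=> /choice[k kP].
have comp : @compatible_families D (fun m => to_residue m (s (k m))).
  move=> m1 m2 m12 d /to_residueP h; apply/to_residueP.
  apply: (@nzideal_trans _ _ _ (s (k m1))); last exact: m12.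
  apply: (@nzideal_trans _ _ _ (s (maxn (k m1) (k m2)))).
    by apply: nzideal_subC; apply: kP; exact: leq_maxr.
  by apply: m12; apply: kP; exact: leq_maxl.
exists (mk_profinite comp) => m; exists (k m) => l kl.
by apply/to_residueP; apply: nzideal_subC; exact: kP.
Qed.

Lemma ex_expr_period (m : nzideal D) (u : D) : exists i r,
  [/\ (i <= ideal_norm m)%N, (0 < r <= ideal_norm m)%N & u ^+ (i + r) - u ^+ i \inI m].
Proof.
pose s := [seq to_residue m (u ^+ i) | i <- iota 0 (ideal_norm m).+1].
have : ~~ uniq s.
  by apply/negP => /(uniq_residue_leq (finD m)); rewrite size_map size_iota ltnn.
move=> /(uniqPn (to_residue m 0))[i [j [ij]]]; rewrite size_map size_iota => jN.
rewrite !(nth_map 0%N) ?size_iota ?nth_iota ?(ltn_trans ij)// !add0n => /esym/to_residueP h.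
exists i, (j - i)%N; rewrite subnKC ?(ltnW ij)//; split=> //; lia.
Qed.

(* The period of the powers of [u] modulo [m] is at most [|D / m|], hence divides
   [l`!] as soon as [|D / m| <= l]. *)
Lemma expr_fact_idempotent (m : nzideal D) (u : D) (k l : nat) :
  (ideal_norm m <= k)%N -> (ideal_norm m <= l)%N ->
  u ^+ k`! * u ^+ l`! - u ^+ k`! \inI m.
Proof.
move=> Nk Nl; have [i [r [iN /andP[r0 rN] per]]] := ex_expr_period m u.
have per' q t : (i <= q)%N -> u ^+ (q + r * t) - u ^+ q \inI m.
  move=> iq; elim: t => [|t IH]; first by rewrite muln0 addn0 subrr; exact: nzideal0.
  apply: nzideal_trans IH; rewrite mulnS.
  have -> : (q + (r + r * t) = (q - i + r * t) + (i + r))%N by lia.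
  have -> : (q + r * t = (q - i + r * t) + i)%N by lia.
  by rewrite !(exprD _ (q - i + r * t)) -mulrBr; exact: nzidealMl.
have /dvdnP[t tE] : (r %| l`!)%N by apply: dvdn_fact; rewrite r0 (leq_trans rN).
rewrite -exprD tE mulnC; apply: per'; apply: (leq_trans iN); apply: (leq_trans Nk).
have [->//|k0] := posnP k.
by apply: dvdn_leq; [exact: fact_gt0|apply: dvdn_fact; rewrite k0 leqnn].
Qed.

(** Modulo a power of a prime, this idempotent is [0] if [u] lies in the prime and [1] otherwise; it
    separates two sets of primes. *)
Lemma ex_fact_limit (u : D) : exists e : Dhat, e * e = e /\
  forall m, exists k, component e m = to_residue m (u ^+ k`!).
Proof.
have [m|e eP] := @profinite_limit (fun k => u ^+ k`!).
  exists (ideal_norm m) => l Nl.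
  apply: (@nzideal_trans _ _ _ (u ^+ l`! * u ^+ (ideal_norm m)`!)).
    by apply: nzideal_subC; exact: expr_fact_idempotent.
  by rewrite mulrC; exact: expr_fact_idempotent.
exists e; split; last by move=> m; have [k kP] := eP m; exists k; exact: kP.
apply: component_inj => m; have [k kP] := eP m.
rewrite componentM (kP (maxn k (ideal_norm m))) ?leq_maxl// -to_residueM.
by apply/to_residueP; apply: expr_fact_idempotent; exact: leq_maxr.
Qed.

Lemma extended_ideal_ideal n : is_ideal (extended_ideal n).
Proof. by rewrite extended_idealE; exact: component_ker_ideal. Qed.

Lemma rho_ideal x : is_ideal (rho x).
Proof.
split=> [|_ _ [y _ <-] [z _ <-]|r _ [y _ <-]].
- by exists 0 => //; rewrite mulr0.
- by exists (y + z) => //; rewrite mulrDr.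
- by exists (r * y) => //; rewrite mulrCA.
Qed.

Lemma rho_sub x (K : set Dhat) : is_ideal K -> K x -> rho x `<=` K.
Proof. by move=> [_ _ KM] Kx _ [y _ <-]; rewrite mulrC; exact: KM. Qed.

(* If [(al) = n c] with [c] prime to [n], the generator is [al] at the primes
   dividing [n] and [1] elsewhere, glued by an idempotent [e]. *)
Lemma extended_ideal_principal n : exists x, rho x = extended_ideal n.
Proof.
have [al [c [al0 alE [v [u [vc un vu]]]]]] := ex_coprime_principal finD cicD n n.
have [e [ee eu]] := ex_fact_limit u.
(* Since [v = 1 - u] divides every [1 - u ^+ k], it divides [1 - e]. *)
have [z zE] : exists z, embed v * z = 1 - e.
  have [v0|v0] := eqVneq v 0.
    exists 0; rewrite mulr0; apply/esym/eqP; rewrite subr_eq0; apply/eqP.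
    apply: component_inj => m; have [k ->] := eu m.
    by move: vu; rewrite v0 add0r => ->; rewrite expr1n.
  apply: embed_divides => //; have [k kE] := eu (pideal v).
  change (to_residue (pideal v) 1 - component e (pideal v) = 0).
  rewrite kE -to_residueN -to_residueD; apply/to_residue_eq0/pidealP => //.
  have -> : v = 1 - u by rewrite -vu addrK.
  by exists (\sum_(i < k`!) u ^+ i); rewrite -opprB subrX1 -mulNr opprB.
have en : extended_ideal n e.
  rewrite extended_idealE /component_ker /=; have [k ->] := eu n.
  by apply/to_residue_eq0; rewrite -(prednK (fact_gt0 k)) exprS; exact: nzidealMr.
have nI := extended_ideal_ideal n; have [_ nD nM] := nI.
pose x := embed al * (1 - e) + e.
have aln : extended_ideal n (embed al).
  apply/extended_ideal_embed; apply: (@idealMl_sub _ n c); rewrite -alE; exact: pideal_id.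
exists x; apply/seteqP; split.
  by apply: rho_sub => //; apply: nD => //; rewrite mulrC; exact: nM.
apply: smallest_sub; first exact: rho_ideal.
move=> _ [be ben <-].
have /(pidealP _ al0)[ga gaE] : be * v \inI pideal al by rewrite alE; exact: idealM_in.
(* The terms produce [be * e] and [be * (1 - e)]: the first because [x * e = e], the second from
   [x * (1 - e) = al * (1 - e)], [be * v = al * ga] and [v * z = 1 - e]. *)
exists (embed be * e + embed ga * z * (1 - e)) => //.
have E1 : embed be * embed v = embed al * embed ga by rewrite -!embedM gaE.
have e1 : e * (1 - e) = 0 by rewrite mulrBr mulr1 ee subrr.
have f1 : (1 - e) * (1 - e) = 1 - e by rewrite mulrBr mulr1 (mulrC (1 - e)) e1 subr0.
have xe : x * e = e by rewrite /x mulrDl -mulrA (mulrC (1 - e)) e1 mulr0 add0r.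
have xf : x * (1 - e) = embed al * (1 - e) by rewrite /x mulrDl -mulrA f1 e1 addr0.
rewrite mulrDr mulrCA xe mulrCA xf.
have -> : embed ga * z * (embed al * (1 - e)) = (embed be * embed v) * z * (1 - e).
  by rewrite E1; ring.
by rewrite -(mulrA (embed be)) zE -mulrA f1 -mulrDr addrC subrK mulr1.
Qed.

End Completion.

(** * Topology and Haar measure *)

Section Topology.
Variable D : idomainType.
Hypothesis finD : forall I : nzideal D, finite_residue I.
Hypothesis cicD : completely_integrally_closed D.
Implicit Types (a b n : nzideal D).
Local Notation Dhat := (profinite_completion D).
Implicit Types (x y z : Dhat).
Let T (a : nzideal D) : discreteTopologicalType := discrete_topology (residue a).
Let P := prod_topology T.

Let proj_cont a : continuous (proj a : P -> T a).
Proof. exact: proj_continuous. Qed.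

Let closed_proj a (A : set (T a)) : closed (proj a @^-1` A : set P).
Proof.
apply: closed_comp; last exact: discrete_closed.
by move=> y _; exact: proj_cont.
Qed.

Lemma compatible_closed : closed (@compatible_families D : set P).
Proof.
have -> : (@compatible_families D : set P) =
    \bigcap_(i in [set i : (nzideal D * nzideal D * D) | i.1.1 `<=` i.1.2])
      ((proj i.1.1 @^-1` (~` [set to_residue i.1.1 i.2] : set (T _))) `|`
       (proj i.1.2 @^-1` ([set to_residue i.1.2 i.2] : set (T _)))).
  apply/seteqP; split=> y.
    move=> h [[a b] d] /= ab; have [E|E] := pselect (y a = to_residue a d).
      by right; exact: h E.
    by left.
  by move=> h a b ab d E; have [|//] := h ((a, b), d) ab; case.
apply: closed_bigI => i _; apply: closedU; exact: closed_proj.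
Qed.

Lemma product_compact : compact [set: P].
Proof.
have -> : [set: P] = [set f : forall a, T a | forall a, [set: T a] (f a)].
  by apply/seteqP.
apply: (@tychonoff _ (fun a => T a : topologicalType) (fun a => [set: T a])) => a.
by apply: finite_compact; exact: finD.
Qed.

(** This is the image of the compact set of compatible families under the continuous multiplication
    by [x] on the Hausdorff product. *)
Lemma rho_closed x : closed (rho x).
Proof.
pose m (y : P) : P := fun a => component x a * (y a : residue a).
have mc : continuous m.
  move=> y; apply/cvg_sup; first exact/fmap_filter/nbhs_filter.
  move=> a; move: y.
  apply/(@continuousP _ (initial_topology (@^~ a))) => A [B oB <-].
  have -> : m @^-1` (@^~ a @^-1` B) =
      proj a @^-1` [set r : T a | B (component x a * (r : residue a))] by [].
  by apply: open_comp; [move=> ? _; exact: proj_cont|exact: discrete_open].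
have Cc : closed (m @` (@compatible_families D : set P)).
  apply: compact_closed.
    by apply: hausdorff_product => a; exact: discrete_hausdorff.
  apply: continuous_compact; first exact: continuous_subspaceT.
  by apply: (subclosed_compact compatible_closed product_compact).
have -> : rho x = (set_val : Dhat -> P) @^-1` (m @` (@compatible_families D : set P)).
  apply/seteqP; split=> z /=.
    by move=> [y _ <-]; exists (\val y); [exact/set_mem/valP|].
  move=> [y yP yz]; exists (mk_profinite yP) => //; apply: component_inj => a.
  by change (m y a = (set_val z : P) a); rewrite yz.
apply: closed_comp; last exact: Cc.
by move=> z _; exact: initial_continuous.
Qed.

Lemma component_fiber_open a (r : residue a) : open [set x : Dhat | component x a = r].
Proof.
have -> : [set x : Dhat | component x a = r] =
  (set_val : Dhat -> P) @^-1` (proj a @^-1` [set r]) by [].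
apply: open_comp; first by move=> z _; exact: initial_continuous.
by apply: open_comp; [move=> ? _; exact: proj_cont|exact: discrete_open].
Qed.

Variable R : realType.
Variable mu : probability (borel D) R.
Hypothesis hmu : haar_measure mu.

Lemma component_fiber_measurable a (r : residue a) :
  measurable ([set x : Dhat | component x a = r] : set (borel D)).
Proof. by apply: sub_sigma_algebra; exact: component_fiber_open. Qed.

Lemma extended_ideal_measurable a : measurable (extended_ideal a : set (borel D)).
Proof. by rewrite (extended_idealE finD cicD); exact: component_fiber_measurable. Qed.

(** The fibres of the component at [a] are translates of the kernel; [ideal_norm a] of them
    partition a space of measure [1]. *)
Lemma extended_ideal_measure a :
  mu (extended_ideal a) = ((ideal_norm a)%:R^-1)%:E.
Proof.
rewrite (extended_idealE finD cicD).
have fiber (r : residue a) : mu [set x : Dhat | component x a = r] = mu (component_ker a).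
  have [d ->] := to_residue_surj r.
  rewrite -(hmu (embed d) (@component_fiber_measurable a 0)); congr (mu _).
  apply/seteqP; split=> x /=.
    move=> xd; exists (x - embed d); last by rewrite addrC subrK.
    by change (component x a - to_residue a d = 0); rewrite xd subrr.
  move=> [y y0 <-]; change (to_residue a d + component y a = to_residue a d).
  by rewrite y0 addr0.
have : mu [set: borel D] = 1%E by exact: probability_setT.
pose F (r : residue a) : set (borel D) := [set x : Dhat | component x a = r].
have -> : [set: borel D] = \bigcup_(r in [set: residue a]) F r.
  by apply/seteqP; split=> // x _; exists (component x a).
rewrite measure_fin_bigcup //; last 3 first.
- exact: finD.
- by apply/trivIsetP => r s _ _ /eqP rs; apply/seteqP; split=> // x [xr xs]; apply: rs; rewrite -xr -xs.
- by move=> r _; exact: component_fiber_measurable.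
rewrite (eq_fsbigr (fun=> mu (component_ker a))); last by move=> r _; exact: fiber.
rewrite fsbig_finite; last exact: finD.
have muK : mu (component_ker a) = (fine (mu (component_ker a)))%:E.
  rewrite fineK // fin_num_measure //; exact: component_fiber_measurable.
rewrite muK sumEFin big_const_seq iter_addr_0 count_predT => -[E].
congr (_%:E); have N0 : (ideal_norm a)%:R != 0 :> R.
  by rewrite pnatr_eq0 -lt0n; exact: ideal_norm_gt0.
by apply: (mulIf N0); rewrite mulVf // mulr_natr; exact: E.
Qed.

End Topology.

(** * Convergence of the zeta function *)

Section Esum.
Variables (R : realType) (T : choiceType).
Implicit Types (X Y : set T) (a : T -> \bar R).
Local Open Scope ereal_scope.

Lemma ge_esum X a (M : \bar R) :
  (forall B, finite_set B -> B `<=` X -> \sum_(i \in B) a i <= M) ->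
  \esum_(i in X) a i <= M.
Proof. by move=> h; apply: ge_ereal_sup => _ [B [fB BX] <-]; exact: h. Qed.

Lemma sub_le_esum X Y a : X `<=` Y -> \esum_(i in X) a i <= \esum_(i in Y) a i.
Proof.
move=> XY; apply: ge_esum => B fB BX; apply: esum_ge; exists B => //.
by split=> // x /BX /XY.
Qed.

Lemma esumZl X a (c : R) : (0 < c)%R -> (forall i, 0 <= a i) ->
  \esum_(i in X) (c%:E * a i) = c%:E * \esum_(i in X) a i.
Proof.
move=> c0 a0; rewrite -[RHS]ereal_sup_pZl //; congr ereal_sup.
apply/seteqP; split=> _ [B hB <-].
  by exists (\sum_(i \in B) a i); [exists B|rewrite ge0_mule_fsumr].
by case: hB => C hC <-; exists C => //; rewrite ge0_mule_fsumr.
Qed.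

End Esum.

Section Summability.
Variables (R : realType) (D : idomainType).
Hypothesis finD : forall I : nzideal D, finite_residue I.
Hypothesis cicD : completely_integrally_closed D.
Implicit Types (a b n I J P : nzideal D) (X Y : set (nzideal D)) (s : R).

Definition weight s n : R := (ideal_norm n)%:R `^ (- s).

Definition ideal_sum s X : \bar R := \esum_(n in X) (weight s n)%:E.

Lemma weight_gt0 s n : 0 < weight s n.
Proof. by rewrite powR_gt0 // ltr0n ideal_norm_gt0. Qed.

Lemma weightM s I J : weight s (idealM I J) = weight s I * weight s J.
Proof. by rewrite /weight ideal_normM // natrM powRM. Qed.

Lemma weight1 s : weight s (ideal1 D) = 1.
Proof. by rewrite /weight ideal_norm1 powR1. Qed.

Lemma weight_le s t n : s <= t -> weight t n <= weight s n.
Proof. by move=> st; rewrite ler_powR ?lerN2// ler1n ideal_norm_gt0. Qed.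

Lemma ideal_sum_ge0 s X : (0 <= ideal_sum s X)%E.
Proof. by apply: esum_ge0 => n _; rewrite lee_fin ltW ?weight_gt0. Qed.

Lemma ideal_sum_fin s X : finite_set X -> ideal_sum s X \is a fin_num.
Proof.
move=> fX; rewrite /ideal_sum esum_fset //; last by move=> n _; rewrite lee_fin ltW ?weight_gt0.
by rewrite fsbig_finite // sumEFin.
Qed.

Lemma ideal_sum_mul s I X :
  ideal_sum s (idealM I @` X) = ((weight s I)%:E * ideal_sum s X)%E.
Proof.
rewrite /ideal_sum esum_image; last by move=> n m _ _; exact: idealMI.
rewrite -esumZl ?weight_gt0//; last by move=> n; rewrite lee_fin ltW ?weight_gt0.
by apply: eq_esum => n _; rewrite weightM EFinM.
Qed.

Lemma maximal_weight s P : 1 < s -> maximal P -> weight s P <= 2^-1.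
Proof.
move=> s1 Pm; apply: (le_trans (weight_le _ (ltW s1))).
rewrite /weight powR_inv1 // lef_pV2 ?posrE ?ltr0n ?ideal_norm_gt0//.
by rewrite ler_nat maximal_norm.
Qed.

Section Primes.
Hypothesis smallD : small_elements D.

(** Every prime of the block contains one of the elements [g], and
    [ideal_norm (pideal g) <= 2 ^ (h * f)] leaves room for at most [h] primes of norm at least
    [2 ^ f] over each [g]. *)
Lemma small_elements_blocks : exists C : nat, forall (f : nat) (T : seq (nzideal D)),
  (0 < f)%N -> uniq T ->
  (forall P, P \in T -> maximal P /\ (2 ^ f <= ideal_norm P < 2 ^ f.+1)%N) ->
  (size T <= C * 2 ^ f)%N.
Proof.
have [C [h hS]] := smallD; exists (h * C)%N => f T f0 uT hT.
have [E [sE gE EI]] := hS f f0.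
have count_g g : g \in E -> (count (fun P => `[< g \inI P >]) T <= h)%N.
  move=> /gE[g0 Ng]; rewrite -size_filter; set Tg := [seq _ <- _ | _].
  have hTg P : P \in Tg -> [/\ maximal P, pideal g `<=` P & (2 ^ f <= ideal_norm P)%N].
    rewrite mem_filter => /andP[/asboolP gP /hT[Pm /andP[Pf _]]].
    by split=> //; exact: pideal_sub.
  have le1 : (\prod_(P <- Tg) ideal_norm P <= ideal_norm (pideal g))%N.
    apply: maximal_norm_prod => //; first exact: filter_uniq.
    by move=> P /hTg[].
  have le2 : ((2 ^ f) ^ size Tg <= \prod_(P <- Tg) ideal_norm P)%N.
    elim: (Tg) hTg => [|P l IH] hl; first by rewrite big_nil.
    rewrite big_cons expnS leq_mul //; first by have [] := hl P (mem_head _ _).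
    by apply: IH => Q Ql; apply: hl; rewrite inE Ql orbT.
  have := leq_trans (leq_trans le2 le1) Ng.
  by rewrite -expnM leq_exp2l // mulnC leq_pmul2r.
have : (size T <= \sum_(g <- E) count (fun P => `[< g \inI P >]) T)%N.
  elim: T hT {uT count_g} => //= P T IH hT.
  rewrite big_split /= -add1n; apply: leq_add; last first.
    by apply: IH => Q QT; apply: hT; rewrite inE QT orbT.
  have [_ /andP[_ Plt]] := hT P (mem_head _ _); have [g gEE gP] := EI P Plt.
  rewrite (big_rem g) //=; apply: leq_trans (leq_addr _ _).
  by rewrite lt0b; apply/asboolP.
move=> /leq_trans; apply.
apply: (@leq_trans (\sum_(g <- E) h)).
  by rewrite big_seq [X in (_ <= X)%N]big_seq; apply: leq_sum => g; exact: count_g.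
by rewrite big_const_seq iter_addn_0 count_predT -mulnA leq_mul2l sE orbT.
Qed.

(** In dyadic blocks, at most [C * 2 ^ f] primes have weight at most [2 ^ (- s * f)]; the geometric
    series of ratio [2 ^ (1 - s)] converges. *)
Lemma prime_sum_bounded s : 1 < s -> exists M : R, forall T : seq (nzideal D), uniq T ->
  (forall P, P \in T -> maximal P) -> \sum_(P <- T) weight s P <= M.
Proof.
move=> s1; have [C hC] := small_elements_blocks.
pose r : R := 2 `^ (- s); have r0 : 0 < r by rewrite powR_gt0.
have r2 : 2 * r < 1.
  rewrite /r -[X in X * _](@powRr1 _ 2) // -powRD; last by rewrite pnatr_eq0 implybT.
  by rewrite /powR pnatr_eq0 /= expR_lt1 pmulr_llt0 ?ln_gt0 ?ltr1n// subr_lt0.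
have r20 : 0 < 1 - 2 * r by rewrite subr_gt0.
exists (C%:R / (1 - 2 * r)) => T uT hT.
pose tl P := trunc_log 2 (ideal_norm P).
have tlP P : P \in T -> (2 ^ tl P <= ideal_norm P < 2 ^ (tl P).+1)%N.
  by move=> _; apply: trunc_log_bounds => //; exact: ideal_norm_gt0.
have wr P : P \in T -> weight s P <= r ^+ tl P.
  move=> PT; have /andP[lo _] := tlP P PT.
  rewrite /weight /r !powRN exprVn -powR_mulrn ?powR_ge0// -powRrM mulrC powRrM powR_mulrn//.
  rewrite lef_pV2 ?posrE ?powR_gt0 ?exprn_gt0 ?ltr0n ?ideal_norm_gt0//.
  by rewrite ge0_ler_powR ?nnegrE ?exprn_ge0// ?(le_trans _ (ltW s1))// -natrX ler_nat.
pose F := \max_(P <- T) tl P.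
have tlF P : P \in T -> (tl P < F.+1)%N.
  by move=> PT; rewrite ltnS /F (big_rem P) //= leq_maxl.
apply: (@le_trans _ _ (\sum_(P <- T) r ^+ tl P)).
  by rewrite big_seq [leRHS]big_seq; apply: ler_sum => P; exact: wr.
rewrite (partition_big (fun P => inord (tl P) : 'I_F.+1) xpredT) //=.
apply: (@le_trans _ _ (\sum_(f < F.+1) C%:R * (2 * r) ^+ f)).
  apply: ler_sum => f _; rewrite big_seq_cond.
  rewrite (eq_bigr (fun=> r ^+ f)); last first.
    by move=> P /andP[PT /eqP <-]; rewrite inordK // tlF.
  rewrite -big_seq_cond big_const_seq iter_addr_0 -[leLHS]mulr_natl exprMn mulrA.
  rewrite ler_wpM2r ?exprn_ge0 ?(ltW r0)// -natrX -natrM ler_nat -size_filter.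
  have hf P : P \in [seq P <- T | inord (tl P) == f] -> P \in T /\ tl P = f.
    rewrite mem_filter => /andP[/eqP fE PT]; split=> //.
    by rewrite -fE inordK // tlF.
  (* The bound on blocks requires [f > 0]; block [0] is empty because maximal ideals have norm at
     least [2]. *)
  have [f0|f0] := posnP f; last first.
    apply: hC => //; first exact: filter_uniq.
    by move=> P /hf[PT tf]; split; [exact: hT|rewrite -tf; exact: tlP].
  rewrite (_ : [seq _ <- _ | _] = [::]) //.
  case E : [seq _ <- _ | _] => [//|P l].
  have [PT] : P \in T /\ tl P = f by apply: hf; rewrite E mem_head.
  have /andP[_] := tlP P PT; have := maximal_norm finD (hT _ PT).
  by rewrite f0 => + + tE; rewrite tE; case: (ideal_norm P) => [|[]].
rewrite -mulr_sumr ler_wpM2l //.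
rewrite -(ler_pM2r r20) mulVf ?lt0r_neq0//; set x := 2 * r; set S := \sum_(f < F.+1) _.
have -> : S * (1 - x) = 1 - x ^+ F.+1.
  by apply: oppr_inj; rewrite opprB subrX1 -/S; ring.
by rewrite gerBl exprn_ge0 // mulr_ge0 ?ltW.
Qed.

Definition support_in (T : seq (nzideal D)) n :=
  forall P, maximal P -> n `<=` P -> P \in T.

(* Splitting off the multiples of [P] turns the sum [Z] over the ideals with
   prime divisors in [P :: T] into [Z <= Z' + |P|^-s Z], [Z'] being the sum for [T]. *)
Lemma support_sum_le s n0 (T : seq (nzideal D)) : 1 < s -> (forall P, P \in T -> maximal P) ->
  (ideal_sum s [set n : nzideal D | n0 `<=` n /\ support_in T n] <=
   (expR (2 * \sum_(P <- T) weight s P))%:E)%E.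
Proof.
move=> s1; pose Z T := ideal_sum s [set n : nzideal D | n0 `<=` n /\ support_in T n].
(* Only finitely many ideals contain [n0], so the sums are finite and [Z (P :: T)] can be moved to
   one side. *)
have Zfin T' : Z T' \is a fin_num.
  by apply: ideal_sum_fin; apply: sub_finite_set (finite_over finD n0) => n [].
elim: T => [_|P T IH hT].
  rewrite big_nil mulr0 expR0; apply: (@le_trans _ _ (ideal_sum s [set ideal1 D])).
    apply: sub_le_esum => n [_ h] /=; apply: contrapT => n1.
    by have [P Pm nP] := ex_maximal finD n1; have := h P Pm nP.
  by rewrite /ideal_sum esum_set1 ?weight1// lee_fin ltW ?weight_gt0.
have Pm : maximal P by apply: hT; rewrite mem_head.
have {IH} : (Z T <= (expR (2 * \sum_(Q <- T) weight s Q))%:E)%E.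
  by apply: IH => Q QT; apply: hT; rewrite inE QT orbT.
have step : (Z (P :: T) <= (weight s P)%:E * Z (P :: T) + Z T)%E.
  rewrite /Z {1}/ideal_sum (esumID [set n : nzideal D | n `<=` P]); last first.
    by move=> n _; rewrite lee_fin ltW ?weight_gt0.
  apply: leeD; last first.
    apply: sub_le_esum => n [[n0n h] nP]; split=> // Q Qm nQ.
    by have := h Q Qm nQ; rewrite inE => /orP[/eqP E|//]; case: nP; rewrite -E.
  rewrite -ideal_sum_mul; apply: sub_le_esum => n [[n0n h] nP].
  have [M ME] := ideal_dvd finD cicD nP; exists M => //.
  have nM : n `<=` M by rewrite ME; exact: idealMr_sub.
  split; first by move=> x /n0n /nM.
  by move=> Q Qm MQ; apply: h => // x /nM /MQ.
move: step; rewrite -/(Z (P :: T)) -(fineK (Zfin (P :: T))) -(fineK (Zfin T)).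
rewrite -EFinM -EFinD !lee_fin big_cons.
have := maximal_weight s1 Pm; have := weight_gt0 s P.
set z := fine (Z (P :: T)); set z' := fine (Z T); set u := weight s P => u0 u2 step IH.
have z'0 : 0 <= z' by rewrite fine_ge0 // ideal_sum_ge0.
have z0 : 0 <= z by rewrite fine_ge0 // ideal_sum_ge0.
rewrite mulrDr expRD.
(* As [u <= 1/2], one has [1 / (1 - u) <= 1 + 2 * u <= expR (2 * u)]. *)
apply: (@le_trans _ _ ((1 + 2 * u) * z')).
  have h1 : 0 <= (z' - (1 - u) * z) by lra.
  have h2 : 0 <= u * (1 - 2 * u) * z by rewrite !mulr_ge0 //; lra.
  have h3 : 0 <= (1 + 2 * u) * (z' - (1 - u) * z) by rewrite mulr_ge0 //; lra.
  rewrite -subr_ge0; apply: le_trans (addr_ge0 h2 h3) _; rewrite le_eqVlt; apply/orP; left.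
  by apply/eqP; ring.
apply: ler_pM => //; last exact: expR_ge1Dx.
by lra.
Qed.

(** Finitely many ideals all contain their intersection [n0], so only the primes over [n0] divide
    them. The exponential bound is uniform in the choice of these ideals. *)
Lemma ideal_sum_lt_pinfty s : 1 < s -> (ideal_sum s [set: nzideal D] < +oo)%E.
Proof.
move=> s1; have [M hM] := prime_sum_bounded s1.
apply: (@le_lt_trans _ _ (expR (2 * M))%:E); last exact: ltry.
apply: ge_esum => B fB _.
pose n0 := \big[@idealI D/ideal1 D]_(n <- fset_set B) n.
have n0B n : B n -> n0 `<=` n.
  move=> Bn; have : n \in enum_fset (fset_set B) by rewrite in_fset_set // mem_set.
  rewrite /n0; elim: (enum_fset (fset_set B)) => // m l IH.
  by rewrite inE big_cons => /orP[/eqP->|/IH h] x [] // _ /h.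
have [T uT hT] := maximals_over finD n0.
have hT' P : P \in T -> maximal P by move=> /hT[].
rewrite -esum_fset //; last by move=> n _; rewrite lee_fin ltW ?weight_gt0.
apply: (@le_trans _ _ (ideal_sum s [set n : nzideal D | n0 `<=` n /\ support_in T n])).
  apply: sub_le_esum => n Bn; split; first exact: n0B.
  by move=> P Pm nP; apply/hT; split=> // x /(n0B _ Bn)/nP.
apply: le_trans (support_sum_le n0 s1 hT') _.
by rewrite lee_fin ler_expR ler_pM2l //; exact: hM.
Qed.

End Primes.
End Summability.

(** * Monotonicity of the densities *)

Section Density.
Variables (R : realType) (D : idomainType).
Hypothesis finD : forall I : nzideal D, finite_residue I.
Hypothesis cicD : completely_integrally_closed D.
Hypothesis smallD : small_elements D.
Implicit Types (a b n I J P : nzideal D) (X Y : set (nzideal D)) (s t : R)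
  (A : seq (nzideal D)).

Let wgt0 s n : (0 <= (weight s n)%:E)%E.
Proof. by rewrite lee_fin ltW // weight_gt0. Qed.

Definition ideal_prob s X : R :=
  fine (ideal_sum s X) / fine (ideal_sum s [set: nzideal D]).

Let sum_fin s X : 1 < s -> ideal_sum s X \is a fin_num.
Proof.
move=> s1; rewrite ge0_fin_numE ?ideal_sum_ge0//.
by apply: le_lt_trans (ideal_sum_lt_pinfty finD cicD smallD s1); exact: sub_le_esum.
Qed.

Lemma ideal_sum_total_gt0 s : 1 < s -> 0 < fine (ideal_sum s [set: nzideal D]).
Proof.
move=> s1; apply: (@lt_le_trans _ _ 1) => //.
rewrite -lee_fin fineK ?sum_fin// -(weight1 D s).
rewrite -(@esum_set1 _ _ (ideal1 D) (fun n => (weight s n)%:E)) ?wgt0 //; exact: sub_le_esum.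
Qed.

Lemma ideal_prob_le s X Y : 1 < s -> X `<=` Y -> ideal_prob s X <= ideal_prob s Y.
Proof.
move=> s1 XY; rewrite ler_pM2r ?invr_gt0 ?ideal_sum_total_gt0//.
by apply: fine_le; [exact: sum_fin|exact: sum_fin|exact: sub_le_esum].
Qed.

Lemma ideal_probT s : 1 < s -> ideal_prob s setT = 1.
Proof. by move=> s1; rewrite /ideal_prob divff // lt0r_neq0 // ideal_sum_total_gt0. Qed.

Lemma ideal_prob0 s : ideal_prob s set0 = 0.
Proof. by rewrite /ideal_prob /ideal_sum esum_set0 mul0r. Qed.

Lemma ideal_probID s X Y : 1 < s ->
  ideal_prob s X = ideal_prob s (X `&` Y) + ideal_prob s (X `&` ~` Y).
Proof.
move=> s1; rewrite -mulrDl -fineD ?sum_fin//; congr (fine _ / _).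
by apply: esumID => n _; exact: wgt0.
Qed.

Lemma ideal_prob_mul s I X : 1 < s ->
  ideal_prob s (idealM I @` X) = weight s I * ideal_prob s X.
Proof.
move=> s1; rewrite /ideal_prob ideal_sum_mul // mulrA; congr (_ / _).
by rewrite fineM ?sum_fin.
Qed.

Definition multiples b : set (nzideal D) := [set n : nzideal D | n `<=` b].

Definition avoiding A : set (nzideal D) :=
  [set n : nzideal D | forall a, a \in A -> ~ (n `<=` a)].

Lemma multiplesE b : multiples b = idealM b @` setT.
Proof.
apply/seteqP; split=> n; first by move=> /(ideal_dvd finD cicD)[M ->]; exists M.
by move=> [M _ <-]; exact: idealMl_sub.
Qed.

Lemma multiplesI a b : multiples a `&` multiples b = multiples (idealI a b).
Proof.
apply/seteqP; split=> n; first by move=> [na nb] x nx; split; [exact: na|exact: nb].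
by move=> h; split=> x /h [].
Qed.

Lemma avoiding_cons a A : avoiding (a :: A) = avoiding A `&` ~` multiples a.
Proof.
apply/seteqP; split=> n.
  by move=> h; split=> [b bA|]; apply: h; rewrite inE ?bA ?orbT ?eqxx.
by move=> [h na] b; rewrite inE => /orP[/eqP->//|]; exact: h.
Qed.

(* Inclusion-exclusion for the mass of the multiples of [b] avoiding [A]; [s = 1]
   gives the Haar measure of the corresponding subset of the completion. *)
Fixpoint avoid_mass s b A : R :=
  if A is a :: A' then avoid_mass s b A' - avoid_mass s (idealI b a) A' else weight s b.

Lemma ideal_prob_avoid s b A : 1 < s ->
  ideal_prob s (multiples b `&` avoiding A) = avoid_mass s b A.
Proof.
move=> s1; elim: A b => [|a A IH] b.
  have -> : avoiding [::] = setT by apply/seteqP.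
  by rewrite setIT multiplesE ideal_prob_mul // ideal_probT // mulr1.
rewrite /= -!IH avoiding_cons setIA.
rewrite (ideal_probID (multiples b `&` avoiding A) (multiples a)) //.
by rewrite (setIAC _ _ (multiples a)) multiplesI [X in _ = X - _]addrC addrK.
Qed.

Lemma multiples1 : multiples (ideal1 D) = setT.
Proof. by apply/seteqP. Qed.

Lemma avoid_mass_cvg b A : avoid_mass s b A @[s --> (1 : R)] --> avoid_mass 1 b A.
Proof.
elim: A b => [|a A IH] b /=; last by apply: cvgB; exact: IH.
have N0 : (ideal_norm b)%:R != 0 :> R by rewrite pnatr_eq0 -lt0n ideal_norm_gt0.
rewrite /weight /powR (negPf N0).
apply: continuous_cvg; first exact: continuous_expR.
by apply: cvgM; [apply: cvgN; exact: cvg_id|exact: cvg_cst].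
Qed.

(** A multiple [P M] lies in [a] exactly when [M] lies in [a : P]. *)
Definition colonize P A := [seq colon a P | a <- A].

Lemma avoiding_multiples P A :
  avoiding A `&` multiples P = idealM P @` avoiding (colonize P A).
Proof.
apply/seteqP; split=> n.
  move=> [nA /(ideal_dvd finD cicD)[M nE]]; exists M => // _ /mapP[a aA ->] Mc.
  by apply: (nA a aA); rewrite nE idealMC; apply/idealM_colon.
move=> [M MA <-]; split; last exact: idealMl_sub.
move=> a aA; rewrite idealMC => /idealM_colon Mc.
by apply: (MA (colon a P)) => //; exact: map_f.
Qed.

(** An ideal not contained in [P] avoids every [a] contained in [P], so only the remaining
    conditions matter for it. *)
Definition not_under P A := [seq a : nzideal D <- A | ~~ `[< a `<=` P >]].

Lemma not_underP P A a : a \in not_under P A <-> a \in A /\ ~ (a `<=` P).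
Proof.
by rewrite mem_filter; split=> [/andP[/asboolPn]//|[aA aP]]; apply/andP; split=> //; apply/asboolPn.
Qed.

Lemma colonize_not_under P A : maximal P -> colonize P (not_under P A) = not_under P A.
Proof.
move=> Pm; rewrite /colonize -[RHS]map_id; apply/eq_in_map => a /not_underP[_ aP].
by apply: coprime_colon; exact: maximal_coprime.
Qed.

(** The probability is split according to whether [P] divides [n]. If it does not, the conditions
    left are prime to [P], hence independent of divisibility by [P]. *)
Lemma ideal_prob_avoiding_prime s P A : 1 < s -> maximal P ->
  ideal_prob s (avoiding A) = weight s P * ideal_prob s (avoiding (colonize P A)) +
    (1 - weight s P) * ideal_prob s (avoiding (not_under P A)).
Proof.
move=> s1 Pm; rewrite (ideal_probID (avoiding A) (multiples P)) //.
rewrite avoiding_multiples ideal_prob_mul //; congr (_ + _).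
have -> : avoiding A `&` ~` multiples P = avoiding (not_under P A) `&` ~` multiples P.
  apply/seteqP; split=> n [nA nP]; split=> // a; first by move=> /not_underP[/nA].
  by move=> aA na; apply: (nA a) => //; apply/not_underP; split=> // aP; apply: nP => x /na/aP.
rewrite mulrBl mul1r.
rewrite {1}(ideal_probID (avoiding (not_under P A)) (multiples P)) //.
by rewrite avoiding_multiples ideal_prob_mul // colonize_not_under // addrC addKr.
Qed.

Lemma ideal_norm_colon_le P a : (ideal_norm (colon a P) <= ideal_norm a)%N.
Proof.
have [] // := @finite_residue_sub _ a (colon a P) _ (finD a).
by move=> x ax y _; exact: nzidealMr.
Qed.

Lemma ideal_norm_colon_lt P a : maximal P -> a `<=` P ->
  (ideal_norm (colon a P) < ideal_norm a)%N.
Proof.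
move=> Pm aP; apply: ideal_norm_lt => //; first by move=> x ax y _; exact: nzidealMr.
move=> E; have [M ME] := ideal_dvd finD cicD aP.
have : M `<=` a by rewrite E; apply/idealM_colon; rewrite idealMC -ME.
rewrite ME -{1}(ideal1M M) idealMC (idealMC P) => /(idealM_subK finD cicD) h.
by case: Pm => P1 _; apply: P1; apply: eq_ideal1; exact: h.
Qed.

(* By induction on the total norm of [A]: at each prime [P] the probability is the
   convex combination of [ideal_prob_avoiding_prime], in which the smaller term
   has the weight [|P|^-s], which decreases with [s]. *)
Lemma ideal_prob_avoiding_le s t A : 1 < s -> s <= t ->
  ideal_prob s (avoiding A) <= ideal_prob t (avoiding A).
Proof.
move=> s1 st; have t1 := lt_le_trans s1 st.
have [k] := ubnP (\sum_(a <- A) ideal_norm a)%N.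
elim: k A => // k IH A; rewrite ltnS => Ak.
have [[a0 a0A a01]|all1] := pselect (exists2 a, a \in A & a <> ideal1 D); last first.
  case: A {Ak} all1 => [_|a A all1].
    have -> : avoiding [::] = setT by apply/seteqP.
    by rewrite !ideal_probT.
  have a1 : a = ideal1 D by apply: contrapT => a1; apply: all1; exists a; rewrite ?mem_head.
  have -> : avoiding (a :: A) = set0.
    by apply/seteqP; split=> // n /(_ a (mem_head _ _)) []; rewrite a1.
  by rewrite !ideal_prob0.
have [P Pm a0P] := ex_maximal finD a01.
have lt1 : (\sum_(a <- colonize P A) ideal_norm a < k)%N.
  apply: leq_trans Ak; rewrite big_map (big_rem a0) //= [X in (_ < X)%N](big_rem a0) //=.
  rewrite -addSn; apply: leq_add; first exact: ideal_norm_colon_lt.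
  by apply: leq_sum => a _; exact: ideal_norm_colon_le.
have lt2 : (\sum_(a <- not_under P A) ideal_norm a < k)%N.
  apply: leq_trans Ak; rewrite big_filter big_mkcond (big_rem a0) //= [X in (_ < X)%N](big_rem a0) //=.
  have -> : `[< a0 `<=` P >] by apply/asboolP.
  rewrite /= add0n; apply: (@leq_trans (1 + \sum_(y <- rem a0 A) ideal_norm y)).
    by rewrite add1n ltnS; apply: leq_sum => a _; case: ifP.
  by rewrite leq_add2r ideal_norm_gt0.
have := IH _ lt1; have := IH _ lt2.
have sub : avoiding (colonize P A) `<=` avoiding (not_under P A).
  move=> n nA a aA; apply: nA; rewrite -(colonize_not_under A Pm) in aA.
  by case/mapP: aA => b /not_underP[bA _] ->; exact: map_f.
have := ideal_prob_le t1 sub.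
rewrite !(ideal_prob_avoiding_prime A _ Pm) //.
have := weight_le finD P st; have := maximal_weight finD s1 Pm; have := weight_gt0 finD s P.
move: (ideal_prob s (avoiding (not_under P A))) (ideal_prob t (avoiding (not_under P A)))
  (ideal_prob s (avoiding (colonize P A))) (ideal_prob t (avoiding (colonize P A)))
  (weight s P) (weight t P) => fs ft gs gt u v u0 u2 vu gf hf hg.
(* From [s] to [t], both values first grow at fixed weight [u]; then the mass [u - v] passes from
   the smaller value [gt] to the larger [ft]. *)
have h1 : 0 <= u * (gt - gs) by rewrite mulr_ge0 ?subr_ge0// ltW.
have h2 : 0 <= (1 - u) * (ft - fs) by rewrite mulr_ge0 ?subr_ge0//; lra.
have h3 : 0 <= (u - v) * (ft - gt) by rewrite mulr_ge0 ?subr_ge0.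
rewrite -subr_ge0; apply: le_trans (addr_ge0 (addr_ge0 h1 h2) h3) _.
by rewrite le_eqVlt; apply/orP; left; apply/eqP; ring.
Qed.

(** By monotonicity the value at [s] dominates those at [t] in []1, s]], which tend to the left-hand
    side as [t] decreases to [1]. *)
Lemma avoid_mass_le s A : 1 < s -> avoid_mass 1 (ideal1 D) A <= ideal_prob s (avoiding A).
Proof.
move=> s1; rewrite leNgt; apply/negP => lt.
have nA : \forall t \near (1 : R), ideal_prob s (avoiding A) < avoid_mass t (ideal1 D) A.
  exact: (cvgr_gt _ (@avoid_mass_cvg (ideal1 D) A) _ lt).
have : \forall t \near (1 : R)^'+, False.
  near=> t.
  have t1 : 1 < t by near: t; exact: nbhs_right_gt.
  have ts : t <= s by near: t; exact: nbhs_right_le.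
  have : ideal_prob s (avoiding A) < avoid_mass t (ideal1 D) A.
    by near: t; exact: cvg_within nA.
  rewrite -ideal_prob_avoid // multiples1 setTI ltNge => /negP; apply.
  exact: ideal_prob_avoiding_le.
by move=> /filter_ex[].
Unshelve. all: by end_near. Qed.

End Density.

(** * The density theorem *)

Section LimSup.
Variables (R : realType) (f : R -> \bar R) (F : set_system R).
Context {FF : ProperFilter F}.
Local Open Scope ereal_scope.

Lemma limf_esup_le (M : \bar R) : (\forall s \near F, f s <= M) -> limf_esup f F <= M.
Proof.
move=> h; rewrite limf_esupE; apply: (@le_trans _ _ (ereal_sup (f @` [set s | f s <= M]))).
  by apply: ereal_inf_lbound; exists [set s | f s <= M].
by apply: ge_ereal_sup => _ [s ? <-].
Qed.

Lemma limf_einf_ge (M : \bar R) : (\forall s \near F, M <= f s) -> M <= limf_einf f F.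
Proof.
move=> h; rewrite limf_einfE; apply: (@le_trans _ _ (ereal_inf (f @` [set s | M <= f s]))).
  by apply: le_ereal_inf_tmp => _ [s ? <-].
by apply: ereal_sup_ubound; exists [set s | M <= f s].
Qed.

Lemma limf_einf_le_esup : limf_einf f F <= limf_esup f F.
Proof.
rewrite limf_einfE limf_esupE; apply: ge_ereal_sup => _ [V FV <-].
apply: le_ereal_inf_tmp => _ [W FW <-].
have [s [Vs Ws]] := filter_ex (filterI FV FW).
apply: (@le_trans _ _ (f s)).
  by apply: ereal_inf_lbound; exists s.
by apply: ereal_sup_ubound; exists s.
Qed.

End LimSup.

Section Main.
Variables (R : realType) (D : idomainType).
Hypothesis finD : forall I : nzideal D, finite_residue I.
Hypothesis cicD : completely_integrally_closed D.
Hypothesis smallD : small_elements D.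
Variable mu : probability (borel D) R.
Hypothesis hmu : haar_measure mu.
Local Notation Dhat := (profinite_completion D).

Definition hat_avoiding (A : seq (nzideal D)) : set (borel D) :=
  [set x : Dhat | forall a, a \in A -> ~ extended_ideal a x].

Lemma hat_avoiding_cons a A :
  hat_avoiding (a :: A) = hat_avoiding A `\` extended_ideal a.
Proof.
apply/seteqP; split=> x.
  by move=> h; split=> [b bA|]; apply: h; rewrite inE ?bA ?orbT ?eqxx.
by move=> [h na] b; rewrite inE => /orP[/eqP->//|]; exact: h.
Qed.

Lemma hat_avoiding_measurable A : measurable (hat_avoiding A).
Proof.
elim: A => [|a A IH]; last first.
  by rewrite hat_avoiding_cons; apply: measurableD => //; exact: extended_ideal_measurable.
by have -> : hat_avoiding [::] = setT by apply/seteqP.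
Qed.

(** The measure obeys the recursion of [avoid_mass], starting from [1 / ideal_norm b], the weight at
    [s = 1]. *)
Lemma haar_avoid b A :
  mu (extended_ideal b `&` hat_avoiding A) = (avoid_mass 1 b A)%:E.
Proof.
have mE c : measurable (extended_ideal c : set (borel D)).
  exact: extended_ideal_measurable.
elim: A b => [|a A IH] b /=.
  have -> : hat_avoiding [::] = setT by apply/seteqP.
  by rewrite setIT extended_ideal_measure // /weight powR_inv1.
have mbA : measurable (extended_ideal b `&` hat_avoiding A : set (borel D)).
  by apply: measurableI => //; exact: hat_avoiding_measurable.
rewrite EFinB -!IH hat_avoiding_cons -extended_ideal_cap // setIAC setIDA.
apply: measureD => //.
by apply: le_lt_trans (probability_le1 mu mbA) _; exact: ltry.
Qed.

Lemma extended_ideal1 : extended_ideal (ideal1 D) = setT.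
Proof.
apply/seteqP; split=> // x _; rewrite extended_idealE //.
change (component x (ideal1 D) = 0).
by have [d ->] := to_residue_surj (component x (ideal1 D)); apply/to_residue_eq0.
Qed.

Lemma haar_avoiding A : mu (hat_avoiding A) = (avoid_mass 1 (ideal1 D) A)%:E.
Proof. by rewrite -haar_avoid extended_ideal1 setTI. Qed.

Variable a : nat -> nzideal D.
Let Y : set Dhat := [set: Dhat] `\` \bigcup_i extended_ideal (a i).
Let calY : set (set Dhat) := @rho D @` Y.
Let A k := [seq a i | i <- iota 0 k].
Let X : set (nzideal D) := [set n : nzideal D | forall i, ~ (n `<=` a i)].

(** Membership of [x] in an ideal depends only on the ideal that [x] generates. *)
Lemma rho_image_preimage : @rho D @^-1` calY = Y.
Proof.
apply/seteqP; split=> x; last by exists x.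
move=> [y [_ yY] yx]; split=> // -[i _ xi]; apply: yY; exists i => //.
have xsub := rho_sub (extended_ideal_ideal finD cicD (a i)) xi.
by apply: xsub; rewrite -yx; exists 1 => //; rewrite mulr1.
Qed.

Lemma calY_closed : calY `<=` @closed_ideals D.
Proof. by move=> _ [x _ <-]; split; [exact: rho_ideal|exact: rho_closed]. Qed.

(** That every [n Dhat] is principal ensures that each ideal of [X] is reached. *)
Lemma calY_ideals : [set n : nzideal D | calY (extended_ideal n)] = X.
Proof.
apply/seteqP; split=> n.
  move=> [x [_ xY] xn] i na; apply: xY; exists i => //.
  apply: ((extended_ideal_le finD cicD n (a i)).2 na).
  by rewrite -xn; exists 1 => //; rewrite mulr1.
move=> nX; have [x xn] := extended_ideal_principal finD cicD n.
exists x => //; split=> // -[i _ xi]; apply: (nX i).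
apply/(extended_ideal_le finD cicD); rewrite -xn.
by apply: rho_sub => //; exact: extended_ideal_ideal.
Qed.

Lemma zeta_ratio (s : R) : 1 < s ->
  (zeta calY s / zeta (@nonzero_ideals D) s = (ideal_prob s X)%:E)%E.
Proof.
move=> s1; have fin (Z : set (nzideal D)) : ideal_sum s Z \is a fin_num.
  rewrite ge0_fin_numE ?ideal_sum_ge0//.
  by apply: le_lt_trans (ideal_sum_lt_pinfty finD cicD smallD s1); exact: sub_le_esum.
have -> : zeta calY s = ideal_sum s X by rewrite /zeta calY_ideals.
have -> : zeta (@nonzero_ideals D) s = ideal_sum s [set: nzideal D].
  by congr esum; apply/seteqP; split=> // n _; exists n.
rewrite /ideal_prob EFinM -[in LHS](fineK (fin X)) -[in LHS](fineK (fin setT)) inver.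
by rewrite gt_eqF // ideal_sum_total_gt0.
Qed.

Lemma YE : Y = \bigcap_k hat_avoiding (A k).
Proof.
apply/seteqP; split=> x.
  by move=> [_ xY] k _ _ /mapP[i _ ->] xi; apply: xY; exists i.
move=> h; split=> // -[i _ xi]; apply: (h i.+1 I (a i)) => //.
by apply: map_f; rewrite mem_iota /= ltnS.
Qed.

Lemma Y_measurable : measurable (Y : set (borel D)).
Proof. by rewrite YE; apply: bigcap_measurableType => k _; exact: hat_avoiding_measurable. Qed.

Lemma haar_Y_le k : (mu Y <= (avoid_mass 1 (ideal1 D) (A k))%:E)%E.
Proof.
rewrite -haar_avoiding; apply: le_measure; rewrite ?inE.
- exact: Y_measurable.
- exact: hat_avoiding_measurable.
- by rewrite YE; exact: bigcap_inf.
Qed.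

(* Every finite set of ideals outside [X] is already excluded by finitely many [a i]. *)
Lemma haar_Y_le_prob (s : R) : 1 < s -> (mu Y <= (ideal_prob s X)%:E)%E.
Proof.
move=> s1; have muY : mu Y = (fine (mu Y))%:E.
  by rewrite fineK // fin_num_measure //; exact: Y_measurable.
rewrite muY lee_fin; set m := fine (mu Y).
have t0 := ideal_sum_total_gt0 finD cicD smallD s1.
set t := fine _ in t0.
have bound (B : set (nzideal D)) : finite_set B -> B `<=` ~` X ->
    ideal_prob s B <= 1 - m.
  move=> fB BX; have ex n : exists i, B n -> n `<=` a i.
    have [Bn|nBn] := pselect (B n); last by exists 0%N.
    by have /existsNP[i /contrapT ni] := BX n Bn; exists i.
  have [i iP] := choice ex.
  pose k := (\max_(n <- fset_set B) i n).+1.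
  have Bk : B `<=` ~` avoiding (A k).
    move=> n Bn /(_ (a (i n))); apply; last exact: iP.
    apply: map_f; rewrite mem_iota /= add0n ltnS (big_rem n) /= ?leq_maxl//.
    by rewrite in_fset_set // mem_set.
  apply: le_trans (ideal_prob_le finD cicD smallD s1 Bk) _.
  have := ideal_probID finD cicD smallD setT (avoiding (A k)) s1.
  rewrite !setTI ideal_probT // => E.
  rewrite lerBrDr -[leRHS]/1 E addrC lerD2r.
  have := haar_Y_le k; rewrite muY lee_fin => /le_trans; apply.
  exact: avoid_mass_le.
(* The sum over the complement is the supremum of its finite subsums, so the bound passes to it. *)
have : ideal_prob s (~` X) <= 1 - m.
  rewrite /ideal_prob ler_pdivrMr // -lee_fin fineK; last first.
    rewrite ge0_fin_numE ?ideal_sum_ge0//.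
    by apply: le_lt_trans (ideal_sum_lt_pinfty finD cicD smallD s1); exact: sub_le_esum.
  apply: ge_esum => B fB BX; have := bound B fB BX.
  rewrite /ideal_prob ler_pdivrMr // -lee_fin fineK ?ideal_sum_fin//.
  by rewrite /ideal_sum esum_fset // => n _; rewrite lee_fin ltW ?weight_gt0.
have := ideal_probID finD cicD smallD setT X s1.
by rewrite !setTI ideal_probT // => E; lra.
Qed.

(** [X] is contained in the set of ideals avoiding the first [k] of the [a i], whose probability
    converges to the right-hand side. *)
Lemma upper_density_le k :
  (upper_analytic_density R calY <= (avoid_mass 1 (ideal1 D) (A k))%:E)%E.
Proof.
apply/lee_addgt0Pr => e e0; apply: limf_esup_le.
near=> s.
have s1 : 1 < s by near: s; exact: nbhs_right_gt.
rewrite zeta_ratio // -EFinD lee_fin.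
apply: (@le_trans _ _ (avoid_mass s (ideal1 D) (A k))).
  rewrite -ideal_prob_avoid // multiples1 setTI; apply: ideal_prob_le => //.
  by move=> n nX _ /mapP[i _ ->]; exact: nX.
apply: ltW; near: s; apply: cvg_within.
by apply: (cvgr_lt _ (@avoid_mass_cvg R D finD (ideal1 D) (A k))); rewrite ltrDl.
Unshelve. all: by end_near. Qed.

(** The measure is continuous along the decreasing sets [hat_avoiding (A k)], whose intersection is
    [Y]. *)
Lemma upper_density_le_haar : (upper_analytic_density R calY <= mu Y)%E.
Proof.
have cvgY : (mu \o (fun k => hat_avoiding (A k))) k @[k --> \oo] --> mu Y.
  rewrite YE; apply: nonincreasing_cvg_mu.
  - by apply: le_lt_trans (probability_le1 mu (hat_avoiding_measurable _)) _; exact: ltry.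
  - by move=> k; exact: hat_avoiding_measurable.
  - by rewrite -YE; exact: Y_measurable.
  - move=> k l kl; apply/subsetPset => x h b /mapP[i ik ->]; apply: h.
    by apply: map_f; move: ik; rewrite !mem_iota /= !add0n => /leq_trans; exact.
rewrite -(cvg_lim _ cvgY) //; apply: lime_ge; first by apply/cvg_ex; exists (mu Y).
by apply: nearW => k /=; rewrite haar_avoiding; exact: upper_density_le.
Qed.

Lemma density_calY : has_analytic_density calY (mu Y).
Proof.
have lo : (mu Y <= lower_analytic_density R calY)%E.
  apply: limf_einf_ge; near=> s.
  have s1 : 1 < s by near: s; exact: nbhs_right_gt.
  by rewrite zeta_ratio //; exact: haar_Y_le_prob.
have mid : (lower_analytic_density R calY <= upper_analytic_density R calY)%E.
  exact: limf_einf_le_esup.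
have up := upper_density_le_haar.
split; apply/le_anti; rewrite ?up ?lo ?andbT /=.
- exact: le_trans lo mid.
- exact: le_trans mid up.
Unshelve. all: by end_near. Qed.

End Main.

Theorem theorem5p16 (R : realType) (D : idomainType)
    (hD : global_dedekind_domain R D)
    (mu : probability (borel D) R) (hmu : haar_measure mu)
    (a : nat -> nzideal D) :
  let Y : set (profinite_completion D) :=
    [set: profinite_completion D] `\` \bigcup_i extended_ideal (a i) in
  let calY : set (set (profinite_completion D)) := @rho D @` Y in
  [/\ calY `<=` @closed_ideals D,
      has_analytic_density calY (mu Y) &
      mu Y = mu (@rho D @^-1` calY)].
Proof.
move=> Y calY; have [finD smallD] := global_field_finite_quotients_small hD.1.
have cicD := global_dedekind_cic hD; split.
- exact: calY_closed.
- exact: density_calY.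
- by rewrite rho_image_preimage.
Qed.
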